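(* Let $(\alpha^*,\pi^* )$ be the true parameter of the stochastic block model and assume (A1), (A2), (A3) (see context) hold for $(\alpha^*,\pi^* )$ and all parameters considered. Let $(\widetilde\alpha,\widetilde\pi)$ be the variational estimators of $(\alpha^*,\pi^* )$ (see context), and assume that $\widetilde\pi$ converges at rate $1/n$ to $\pi^*$, i.e. $\|\widetilde\pi-\pi^*\|_\infty=O_{\mathbb{P}}(1/n)$. Then $$d(\widetilde\alpha,\alpha^* )\xrightarrow[n\to+\infty]{\mathbb{P}}0,$$ where $d$ denotes any distance between vectors in $\mathbb{R}^Q$ (understood up to label switching leaving $\pi^*$ invariant, see context).
   Context: Stochastic block model (SBM): $Q$ is fixed and known. With parameters $(\alpha,\pi)$, where $\alpha$ is a probability vector in $(0,1)^Q$ and $\pi\in[0,1]^{Q\times Q}$, the labels $Z=(Z_i)_{i\geq1}$ are i.i.d. with $\mathbb{P}(Z_i=q)=\alpha_q$; given $Z$, the $X_{i,j}$, $i\neq j$, are independent Bernoulli$(\pi_{Z_i,Z_j})$, and $X_{i,i}=0$. $X_{[n]}=(X_{i,j})_{1\leq i,j\leq n}$. $\mathbb{P}$ is the law under $(\alpha^*,\pi^* )$ and $\xrightarrow{\mathbb{P}}$ is convergence in probability. $\|\cdot\|_\infty$ is the maximum of absolute values of the entries. Variational estimators: $\mathcal{S}_n$ is the set of $\tau_{[n]}=(\tau_{i,q})_{1\leq i\leq n,1\leq q\leq Q}$ with $\tau_{i,q}\in[0,1]$ and $\sum_q\tau_{i,q}=1$ for every $i$, and $$\mathcal{J}(X_{[n]};\tau_{[n]},\alpha,\pi)=\sum_{i\neq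 j}\sum_{q,l}[X_{i,j}\log\pi_{q,l}+(1-X_{i,j})\log(1-\pi_{q,l})]\tau_{i,q}\tau_{j,l}-\sum_{i,q}\tau_{i,q}(\log\tau_{i,q}-\log\alpha_q).$$ With $\widehat\tau_{[n]}=\widehat\tau_{[n]}(\pi,\alpha)=\operatorname{argmax}_{\tau_{[n]}\in\mathcal{S}_n}\mathcal{J}(X_{[n]};\tau_{[n]},\alpha,\pi)$, the variational estimators are $(\widetilde\alpha,\widetilde\pi)=\operatorname{argmax}_{\alpha,\pi}\mathcal{J}(X_{[n]};\widehat\tau_{[n]},\alpha,\pi)$, the maximum being over parameters satisfying (A1)-(A3) and assumed to be attained. Conventions: $0\log0=0$, $0\cdot(-\infty)=0$, $\log0=-\infty$. Label switching: the criterion is invariant under $(\alpha,\pi)\mapsto(\alpha^\sigma,\pi^\sigma)$ with $\alpha^\sigma_q=\alpha_{\sigma(q)}$, $\pi^\sigma_{q,l}=\pi_{\sigma(q),\sigma(l)}$, so $(\widetilde\alpha,\widetilde\pi)$ is defined up to such a relabelling; the hypothesis on $\widetilde\pi$ refers to a labelling of $(\widetilde\alpha,\widetilde\pi)$ for which it holds, and the conclusion is for that labelling. Since labels related by $\mathfrak{S}^{\pi^*}=\{\sigma:(\pi^* )^\sigma=\pi^*\}$ are identified, $d(\widetilde\alpha,\alpha^* )$ stands for $\min_{\sigma\in\mathfrak{S}^{\pi^*}}d_0(\widetilde\alpha^\sigma,\alpha^* )$ with $d_0$ any distance on $\mathbb{R}^Q$ inducing the usual topology. (A1) for every $q\neq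 q'$ there is $l$ with $\pi_{q,l}\neq\pi_{q',l}$ or $\pi_{l,q}\neq\pi_{l,q'}$. (A2) for all $(q,l)$, $\pi_{q,l}\in(0,1)$ implies $\pi_{q,l}\in[\zeta,1-\zeta]$, with $\zeta>0$ a fixed constant not depending on $n$. (A3) $\alpha_q\in[\gamma,1-\gamma]$ for all $q$, with $0<\gamma<1/Q$ a fixed constant not depending on $n$. *)

(* Defs.v *)
From HB Require Import structures.
From mathcomp Require Import all_boot all_order all_algebra all_fingroup.
From mathcomp Require Import all_classical all_reals all_analysis.

Set Implicit Arguments.
Unset Strict Implicit.
Unset Printing Implicit Defensive.

Import Order.TTheory GRing.Theory Num.Theory.
Import numFieldNormedType.Exports.

Local Open Scope classical_set_scope.
Local Open Scope ring_scope.

(* Groups, labels and nodes are numbered from 0. *)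

(* A parameter of the model with Q groups: the pair (alpha, pi). *)
Notation sbm_parameter R Q := ('rV[R]_Q * 'M[R]_Q)%type.

Section parameters.
Variables (R : realType) (Q : nat).
Implicit Types (alpha : 'rV[R]_Q) (pi : 'M[R]_Q) (theta : sbm_parameter R Q).

Definition sbm_valid theta : Prop :=
  [/\ forall q, 0 < theta.1 0 q < 1,
      \sum_q theta.1 0 q = 1 &
      forall q l, 0 <= theta.2 q l <= 1].

Definition condA1 pi : Prop :=
  forall q q', q != q' -> exists l, pi q l <> pi q' l \/ pi l q <> pi l q'.

Definition condA2 (zeta : R) pi : Prop :=
  forall q l, 0 < pi q l < 1 -> zeta <= pi q l <= 1 - zeta.

Definition condA3 (gamma : R) alpha : Prop :=
  forall q, gamma <= alpha 0 q <= 1 - gamma.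

Definition admissible (gamma zeta : R) : set (sbm_parameter R Q) :=
  [set theta | [/\ sbm_valid theta, condA1 theta.2, condA2 zeta theta.2 &
                   condA3 gamma theta.1]].

Definition relabel_alpha (s : 'S_Q) alpha : 'rV[R]_Q := \row_q alpha 0 (s q).

Definition relabel_pi (s : 'S_Q) pi : 'M[R]_Q := \matrix_(q, l) pi (s q) (s l).

Definition is_distance (d0 : 'rV[R]_Q -> 'rV[R]_Q -> R) : Prop :=
  [/\ forall x y, 0 <= d0 x y,
      forall x y, d0 x y = 0 <-> x = y,
      forall x y, d0 x y = d0 y x &
      forall x y z, d0 x z <= d0 x y + d0 y z].

Definition induces_usual_topology (d0 : 'rV[R]_Q -> 'rV[R]_Q -> R) : Prop :=
  forall (x : 'rV[R]_Q) (A : set 'rV[R]_Q),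
    nbhs x A <-> exists2 e : R, 0 < e & [set y | d0 x y < e] `<=` A.

(* The default value of the iterated minimum is the term of the identity
   permutation, which always leaves pi invariant. *)
Definition dist_upto (d0 : 'rV[R]_Q -> 'rV[R]_Q -> R) pi
    (a b : 'rV[R]_Q) : R :=
  \big[Num.min/d0 a b]_(s : 'S_Q | relabel_pi s pi == pi)
     d0 (relabel_alpha s a) b.

End parameters.

Section criterion.
Variables (R : realType) (Q : nat).

Definition argmax (U : Type) (D : set U) (f : U -> \bar R) : set U :=
  [set u | D u /\ forall v, D v -> (f v <= f u)%E].

Definition tau_set (n : nat) : set 'M[R]_(n, Q) :=
  [set tau | (forall i q, 0 <= tau i q <= 1) /\
             (forall i, \sum_q tau i q = 1)].

(* [lne] sends 0 to -oo, and 0 * -oo = 0 in \bar R. *)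
Definition J (n : nat) (x : 'M[bool]_n) (tau : 'M[R]_(n, Q))
    (theta : sbm_parameter R Q) : \bar R :=
  (\sum_(i < n) \sum_(j < n | i != j) \sum_(q < Q) \sum_(l < Q)
     ((x i j)%:R%:E * lne (theta.2 q l)%:E
      + (1 - (x i j)%:R)%R%:E * lne (1 - theta.2 q l)%R%:E)
     * (tau i q * tau j l)%R%:E
   - \sum_(i < n) \sum_(q < Q)
       (tau i q)%:E * (lne (tau i q)%:E - lne (theta.1 0 q)%:E))%E.

(* A selection of the maximisers of J over tau, for all data x and all
   admissible parameters. *)
Definition is_tau_hat (gamma zeta : R)
    (tau_hat : forall n, 'M[bool]_n -> sbm_parameter R Q -> 'M[R]_(n, Q)) :=
  forall n (x : 'M[bool]_n) theta, admissible gamma zeta theta ->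
    argmax (@tau_set n) (fun tau => J x tau theta) (tau_hat n x theta).

Definition is_variational_estimator (gamma zeta : R)
    (tau_hat : forall n, 'M[bool]_n -> sbm_parameter R Q -> 'M[R]_(n, Q))
    (n : nat) (x : 'M[bool]_n) (theta : sbm_parameter R Q) : Prop :=
  argmax (admissible gamma zeta)
    (fun theta' => J x (tau_hat n x theta') theta') theta.

End criterion.

Section model.
Context {d : measure_display} {T : measurableType d} {R : realType}.
Variable P : probability T R.

Definition iid_labels (Q : nat) (alpha : 'rV[R]_Q) (Z : nat -> T -> 'I_Q) :=
  [/\ forall i q, measurable (Z i @^-1` [set q]),
      forall i q, P (Z i @^-1` [set q]) = (alpha 0 q)%:E &
      forall (s : seq nat) (z : nat -> 'I_Q), uniq s ->
        P (\bigcap_(i in [set` s]) (Z i @^-1` [set z i])) =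
        (\prod_(i <- s) P (Z i @^-1` [set z i]))%E].

Definition observed (X : nat -> nat -> T -> bool) (n : nat) (w : T) :
  'M[bool]_n := \matrix_(i, j) X i j w.

(* Conditional independence of the X_(i,j) given the labels, with the
   conditioning probability multiplied out. *)
Definition bernoulli_edges (Q : nat) (pi : 'M[R]_Q)
    (Z : nat -> T -> 'I_Q) (X : nat -> nat -> T -> bool) :=
  [/\ forall i j, measurable (X i j @^-1` [set true]),
      forall i w, X i i w = false &
      forall (n : nat) (z : 'I_n -> 'I_Q) (x : 'M[bool]_n),
        let Ez := [set w | forall i : 'I_n, Z i w = z i] in
        let Ex := [set w | forall i j : 'I_n, i != j -> X i j w = x i j] in
        P (Ez `&` Ex) =
        (P Ez * (\prod_(i < n) \prod_(j < n | i != j)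
                   bernoulli_pmf (pi (z i) (z j)) (x i j))%:E)%E].

Definition sbm (Q : nat) (theta : sbm_parameter R Q)
    (Z : nat -> T -> 'I_Q) (X : nat -> nat -> T -> bool) :=
  iid_labels theta.1 Z /\ bernoulli_edges theta.2 Z X.

Definition borel_measurable (U : topologicalType) (Y : T -> U) : Prop :=
  forall A : set U, open A -> measurable (Y @^-1` A).

(* E n is not required to be measurable, only to contain events whose
   probability tends to 1. *)
Definition with_high_probability (E : nat -> set T) : Prop :=
  exists A : nat -> set T,
    [/\ forall n, measurable (A n), forall n, A n `<=` E n &
        P (A n) @[n --> \oo] --> 1%E].

Definition bigO_in_probability (Y : nat -> T -> R) (r : nat -> R) : Prop :=
  forall e : R, 0 < e -> exists M : R, \forall n \near \oo,
    (P [set w | (M * r n < `|Y n w|)%R] <= e%:E)%E.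

Definition cvg_in_probability (Y : nat -> T -> R) (l : R) : Prop :=
  forall e : R, 0 < e ->
    P [set w | e < `|Y n w - l|] @[n --> \oo] --> 0%E.

End model.

(* Main.v *)
Require Import Defs.
From HB Require Import structures.
From mathcomp Require Import all_boot all_order all_algebra all_fingroup.
From mathcomp Require Import all_classical all_reals all_analysis.
From mathcomp Require Import ring lra.

Set Implicit Arguments.
Unset Strict Implicit.
Unset Printing Implicit Defensive.

Import Order.TTheory GRing.Theory Num.Theory.
Import numFieldNormedType.Exports.

Local Open Scope classical_set_scope.
Local Open Scope ring_scope.

(** Write x for the observed graph, z for the true labels, tau for the
    maximiser of the criterion at the estimator theta = (alpha, pi), and
    W i j = x i j - pi* (z i) (z j) for the centred edges.

    Profiling the criterion over tau and then over theta is a joint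
    maximisation, so J at (tau, theta) is at least J at (true labels, theta* ).
    The double sum over pairs of nodes has order n^2 and the entropy part only
    order n, so this comparison is one between log-likelihoods.  In both of
    them x may be replaced by its conditional mean pi* (z i) (z j): the error
    is a combination of bilinear forms u^T W v with entries of u and v in
    [0, 1], and these are o(n^2) uniformly in u and v, because their fourth
    power is at most n^4 times the sum of the squared entries of the Gram
    matrix W^T W, whose mean is at most 2 n^3 ([bilinear_gram],
    [product_mean_gram]).  What is left is a sum of Kullback-Leibler
    divergences between Bernoulli laws, which dominate squared differences of
    parameters.  Since pi tends to pi* (this is what the rate provides), the
    conclusion is [misclassification_le]: the sum over i, j, q, l of
    (pi* (z i) (z j) - pi* q l)^2 tau_iq tau_jl is o(n^2).

    Let T q a be the proportion, among the n nodes, of those of true label a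
    that tau puts in group q, counted with weights.  Then T q a T l b (pi* a b - pi* q l)^2 is small
    for all a, b, q, l.  Taking for s a the group that receives the
    largest share of label a, this forces pi* a b = pi* (s a) (s b); by (A1), s is a
    permutation and T q a is small unless q = s a ([near_permutation]).
    Hence the mean of tau in group s a is close to the frequency of label a,
    and so to alpha* a.

    Finally, alpha minimises the cross-entropy of these means among the
    admissible vectors, to which the relabelled alpha* belongs; Gibbs'
    inequality with a quadratic remainder then puts alpha (s a) close to
    alpha* a ([entropy_argmax_dist]).

    All probabilities are computed on the finite set of values of the labels
    and edges of n nodes, where the model is a product law for the labels and,
    given the labels, a product law for the edges. *)

(** * Moments under finite product weights *)

Section finite_product.
Variables (R : realType) (I B : finType).
Implicit Types (p w : I -> B -> R) (s : seq I).

Lemma prod_seq_count (F : I -> R) s :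
  \prod_(k <- s) F k = \prod_i F i ^+ count_mem i s.
Proof.
elim: s => [|k s IH]; first by rewrite big_nil big1.
rewrite big_cons IH (bigD1 k) //= [in RHS](bigD1 k) //= eqxx exprS mulrA.
by congr (_ * _); apply: eq_bigr => i; rewrite eq_sym => /negPf ->.
Qed.

(** When each [p i] sums to one, this is the expectation of [G] under the law
    of independent coordinates with weights [p i]. *)
Definition product_mean p (G : {ffun I -> B} -> R) : R :=
  \sum_(x : {ffun I -> B}) (\prod_i p i (x i)) * G x.

(** The list [s] may repeat indices: grouping equal indices turns a monomial
    in the coordinates into a product over the coordinates. *)
Lemma product_mean_prod p w s :
  product_mean p (fun x => \prod_(k <- s) w k (x k)) =
  \prod_i \sum_b p i b * w i b ^+ count_mem i s.
Proof.
rewrite bigA_distr_bigA; apply: eq_bigr => x _.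
by rewrite (prod_seq_count (fun k => w k (x k))) big_split.
Qed.

Lemma product_mean_sum p (K : finType) (G : K -> {ffun I -> B} -> R) :
  product_mean p (fun x => \sum_k G k x) = \sum_k product_mean p (G k).
Proof.
rewrite /product_mean exchange_big; apply: eq_bigr => x _.
by rewrite mulr_sumr.
Qed.

Lemma product_meanD p (G H : {ffun I -> B} -> R) :
  product_mean p (fun x => G x + H x) = product_mean p G + product_mean p H.
Proof.
by rewrite /product_mean -big_split; apply: eq_bigr => x _; rewrite mulrDr.
Qed.

Lemma product_meanZ p c (G : {ffun I -> B} -> R) :
  product_mean p (fun x => c * G x) = c * product_mean p G.
Proof.
by rewrite /product_mean mulr_sumr; apply: eq_bigr => x _; rewrite mulrCA.
Qed.

Lemma product_mean_cst p c : (forall i, \sum_b p i b = 1) ->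
  product_mean p (fun=> c) = c.
Proof.
by move=> p1; rewrite /product_mean -mulr_suml -bigA_distr_bigA big1 ?mul1r.
Qed.

Lemma product_mean_le p (G H : {ffun I -> B} -> R) :
  (forall i b, 0 <= p i b) -> (forall x, G x <= H x) ->
  product_mean p G <= product_mean p H.
Proof.
move=> p0 GH; apply: ler_sum => x _; apply: ler_wpM2l => //.
exact: prodr_ge0.
Qed.

(** A centred coordinate that occurs exactly once in a monomial makes its mean
    vanish, by independence; this is the source of all the cancellations. *)
Lemma product_mean_centered p w s e :
  \sum_b p e b * w e b = 0 -> count_mem e s = 1%N ->
  product_mean p (fun x => \prod_(k <- s) w k (x k)) = 0.
Proof.
move=> we se; rewrite product_mean_prod (bigD1 e) //= se.
by under eq_bigr do rewrite expr1; rewrite we mul0r.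
Qed.

Lemma product_mean_prod_le1 p w s : (forall i b, 0 <= p i b) ->
  (forall i, \sum_b p i b = 1) -> (forall i b, `|w i b| <= 1) ->
  product_mean p (fun x => \prod_(k <- s) w k (x k)) <= 1.
Proof.
move=> p0 p1 w1; apply: (le_trans (y := product_mean p (fun=> 1))); last first.
  by rewrite product_mean_cst.
apply: product_mean_le => // x.
apply: le_trans (ler_norm _) _; rewrite normr_prod.
apply: (le_trans (y := \prod_(k <- s) 1)); last by rewrite big1_eq.
by apply: ler_prod => i _; rewrite normr_ge0 w1.
Qed.

End finite_product.

Lemma sum_eq_nat (R : realType) n (i : 'I_n) :
  \sum_(j < n) (i == j)%:R = 1 :> R.
Proof.
rewrite (bigD1 i) //= eqxx big1 ?addr0 // => j.
by rewrite eq_sym => /negPf ->.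
Qed.

Lemma variance_sum_le (R : realType) n (B : finType) (p w : 'I_n -> B -> R) :
  (forall i b, 0 <= p i b) -> (forall i, \sum_b p i b = 1) ->
  (forall i b, `|w i b| <= 1) -> (forall i, \sum_b p i b * w i b = 0) ->
  product_mean p (fun x => (\sum_i w i (x i)) ^+ 2) <= n%:R.
Proof.
move=> p0 p1 w1 w0.
pose G (ij : 'I_n * 'I_n) (x : {ffun 'I_n -> B}) :=
  \prod_(k <- [:: ij.1; ij.2]) w k (x k).
have -> : (fun x : {ffun 'I_n -> B} => (\sum_i w i (x i)) ^+ 2) =
    (fun x => \sum_ij G ij x).
  apply/funext => x; rewrite expr2 mulr_suml.
  under [LHS]eq_bigr do rewrite mulr_sumr.
  rewrite pair_bigA /=; apply: eq_bigr => -[i j] _.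
  by rewrite /G /= big_cons big_seq1.
rewrite product_mean_sum.
have le_diag ij : product_mean p (G ij) <= (ij.1 == ij.2)%:R.
  case: ij => i j /=; case: (eqVneq i j) => [_|ij].
    exact: product_mean_prod_le1.
  by rewrite (@product_mean_centered _ _ _ p w _ i) //= eqxx eq_sym (negPf ij).
apply: le_trans (ler_sum _ (fun ij _ => le_diag ij)) _.
rewrite -(pair_bigA _ (fun i j : 'I_n => (i == j)%:R)) /=.
under eq_bigr do rewrite sum_eq_nat.
by rewrite sumr_const card_ord.
Qed.

Lemma sqr_sum_le (R : realType) (I : finType) (a : I -> R) :
  (\sum_i a i) ^+ 2 <= #|I|%:R * \sum_i a i ^+ 2.
Proof.
have twice : \sum_i \sum_j (a i ^+ 2 + a j ^+ 2) =
    2 * (#|I|%:R * \sum_i a i ^+ 2).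
  under eq_bigr do rewrite big_split /= sumr_const.
  by rewrite big_split /= sumr_const sumrMnl -mulr_natl; ring.
rewrite -(@ler_pM2l _ 2) // -twice expr2 mulr_suml mulr_sumr.
apply: ler_sum => i _; rewrite !mulr_sumr.
apply: ler_sum => j _; have := sqr_ge0 (a i - a j); nra.
Qed.

(** Cauchy-Schwarz twice: (u^T W v)^2 <= n |W v|^2 and
    |W v|^2 = v^T (W^T W) v, whose square is at most n^2 times the sum of the
    squared entries of W^T W.  The bound is uniform in [u] and [v], which
    replaces a union bound over the vertices of the cube. *)
Lemma bilinear_gram (R : realType) n (W : 'I_n -> 'I_n -> R) (u v : 'I_n -> R) :
  (forall i, 0 <= u i <= 1) -> (forall i, 0 <= v i <= 1) ->
  (\sum_i \sum_j W i j * (u i * v j)) ^+ 4 <=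
  n%:R ^+ 4 * \sum_j \sum_k (\sum_i W i j * W i k) ^+ 2.
Proof.
move=> u01 v01; pose r i := \sum_j W i j * v j.
have -> : \sum_i \sum_j W i j * (u i * v j) = \sum_i u i * r i.
  by apply: eq_bigr => i _; rewrite mulr_sumr; apply: eq_bigr => j _; ring.
have sq_le (a b : R) : 0 <= a <= 1 -> (a * b) ^+ 2 <= b ^+ 2.
  move=> a01; rewrite exprMn -[leRHS]mul1r ler_wpM2r ?sqr_ge0 //.
  by rewrite expr_le1 //; case/andP: a01.
have step1 : (\sum_i u i * r i) ^+ 2 <= n%:R * \sum_i r i ^+ 2.
  apply: le_trans (sqr_sum_le _) _; rewrite card_ord.
  by apply: ler_wpM2l => //; apply: ler_sum => i _; exact: sq_le.
have step2 : (\sum_i r i ^+ 2) ^+ 2 <=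
    n%:R ^+ 2 * \sum_j \sum_k (\sum_i W i j * W i k) ^+ 2.
  have -> : \sum_i r i ^+ 2 =
      \sum_jk v jk.1 * v jk.2 * \sum_i W i jk.1 * W i jk.2.
    rewrite -(pair_bigA _ (fun j k => v j * v k * \sum_i W i j * W i k)) /=.
    under [RHS]eq_bigr do under eq_bigr do rewrite mulr_sumr.
    under [RHS]eq_bigr do rewrite exchange_big.
    rewrite exchange_big; apply: eq_bigr => i _.
    rewrite expr2 mulr_suml; apply: eq_bigr => j _; rewrite mulr_sumr.
    by apply: eq_bigr => k _; ring.
  apply: le_trans (sqr_sum_le _) _; rewrite card_prod card_ord natrM -expr2.
  apply: ler_wpM2l; first exact: sqr_ge0.
  rewrite [leRHS]pair_bigA; apply: ler_sum => -[j k] _ /=; apply: sq_le.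
  have /andP[? ?] := v01 j; have /andP[? ?] := v01 k.
  by rewrite mulr_ge0 // mulr_ile1.
rewrite -[4%N]/(2 * 2)%N !exprM.
apply: (le_trans (y := (n%:R * \sum_i r i ^+ 2) ^+ 2)).
  rewrite ler_pXn2r // ?nnegrE ?sqr_ge0 //.
  by rewrite mulr_ge0 // sumr_ge0 // => i _; exact: sqr_ge0.
rewrite exprMn [n%:R ^+ 2 ^+ 2]expr2 -mulrA ler_wpM2l //; exact: sqr_ge0.
Qed.

(** The square of entry (j, k) of the Gram matrix is a sum over pairs (i, i')
    of products of four entries of the random matrix.  If j <> k and i <> i'
    these four entries sit at distinct places and the mean is zero; there are
    at most n^3 terms with j = k and n^3 terms with i = i'. *)
Lemma product_mean_gram (R : realType) n (p w : 'I_n * 'I_n -> bool -> R) :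
  (forall i b, 0 <= p i b) -> (forall i, \sum_b p i b = 1) ->
  (forall i b, `|w i b| <= 1) -> (forall i, \sum_b p i b * w i b = 0) ->
  product_mean p (fun x =>
    \sum_j \sum_k (\sum_i w (i, j) (x (i, j)) * w (i, k) (x (i, k))) ^+ 2)
  <= 2 * n%:R ^+ 3.
Proof.
move=> p0 p1 w1 w0.
pose G (c : ('I_n * 'I_n) * ('I_n * 'I_n)) (x : {ffun 'I_n * 'I_n -> bool}) :=
  \prod_(e <- [:: (c.2.1, c.1.1); (c.2.1, c.1.2);
                  (c.2.2, c.1.1); (c.2.2, c.1.2)]) w e (x e).
have -> : (fun x : {ffun 'I_n * 'I_n -> bool} => \sum_j \sum_k
      (\sum_i w (i, j) (x (i, j)) * w (i, k) (x (i, k))) ^+ 2) =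
    (fun x => \sum_c G c x).
  apply/funext => x; rewrite pair_bigA /=.
  rewrite -(pair_bigA _ (fun jk ii => G (jk, ii) x)) /=.
  apply: eq_bigr => -[j k] _ /=; rewrite expr2 mulr_suml.
  under [LHS]eq_bigr do rewrite mulr_sumr.
  rewrite pair_bigA /=; apply: eq_bigr => -[i i'] _.
  by rewrite /G /= !big_cons big_nil /=; ring.
rewrite product_mean_sum.
have le_diag c : product_mean p (G c) <=
    (c.1.1 == c.1.2)%:R + (c.2.1 == c.2.2)%:R.
  case: c => -[j k] [i i'] /=.
  case: (eqVneq j k) => [_|jk].
    apply: (le_trans (product_mean_prod_le1 _ p0 p1 w1)).
    by rewrite lerDl.
  case: (eqVneq i i') => [_|ii].
    by rewrite add0r; exact: product_mean_prod_le1.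
  rewrite (@product_mean_centered _ _ _ p w _ (i, j)) ?addr0 //=.
  by rewrite !xpair_eqE !eqxx ![_ == i]eq_sym ![_ == j]eq_sym
    (negPf jk) (negPf ii) ?andbF.
apply: le_trans (ler_sum _ (fun c _ => le_diag c)) _.
rewrite big_split /=.
rewrite -(pair_bigA _ (fun c d : 'I_n * 'I_n => (c.1 == c.2)%:R)) /=.
rewrite -(pair_bigA _ (fun c d : 'I_n * 'I_n => (d.1 == d.2)%:R)) /=.
have diagE : \sum_(c : 'I_n * 'I_n) (c.1 == c.2)%:R = n%:R :> R.
  rewrite -(pair_bigA _ (fun i j : 'I_n => (i == j)%:R)) /=.
  under eq_bigr do rewrite sum_eq_nat.
  by rewrite sumr_const card_ord.
under eq_bigr do rewrite sumr_const.
rewrite sumrMnl diagE sumr_const card_prod card_ord -(mulr_natl _ (n * n)).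
rewrite -(mulr_natl _ (n * n)) natrM.
by rewrite le_eqVlt; apply/orP; left; apply/eqP; ring.
Qed.

(** * Logarithmic inequalities *)

Section logarithms.
Variable R : realType.
Implicit Types p q r c t eta : R.

Lemma ln_le_subr1 q : 0 < q -> ln q <= q - 1.
Proof.
move=> q0; have -> : ln q = ln (1 + (q - 1)) by congr ln; ring.
by apply: le_ln1Dx; lra.
Qed.

(** One term of Gibbs' inequality, with a quadratic remainder: passing to
    square roots, ln t - ln s <= t / s - 1, and the defect is the squared
    Hellinger distance (sqrt q - sqrt p)^2, at least (q - p)^2 / 4 on the unit
    interval. *)
Lemma gibbs_term p q : 0 <= p <= 1 -> 0 < q <= 1 ->
  p * (ln q - ln p) <= q - p - (q - p) ^+ 2 / 4.
Proof.
move=> /andP[p0 p1] /andP[q0 q1]; have [->|pn0] := eqVneq p 0.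
  rewrite mul0r; nra.
have {}p0 : 0 < p by rewrite lt_neqAle eq_sym pn0.
pose s := Num.sqrt p; pose t := Num.sqrt q.
have s0 : 0 < s by rewrite sqrtr_gt0.
have t0 : 0 < t by rewrite sqrtr_gt0.
have ps : p = s ^+ 2 by rewrite sqr_sqrtr // ltW.
have qt : q = t ^+ 2 by rewrite sqr_sqrtr // ltW.
have s1 : s <= 1 by rewrite -(@expr_le1 _ 2) -?ps // ltW.
have t1 : t <= 1 by rewrite -(@expr_le1 _ 2) -?qt // ltW.
have lnst : s * (ln t - ln s) <= t - s.
  rewrite -ln_div ?posrE //.
  have -> : t - s = s * (t / s - 1) by field; rewrite gt_eqF.
  by rewrite ler_pM2l // ln_le_subr1 ?divr_gt0.
rewrite ps qt !lnXn // -mulrnBl -(mulr_natl _ 2).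
have : s * (s * (ln t - ln s)) <= s * (t - s) by rewrite ler_pM2l.
set L := ln t - ln s => sL.
suff : (t ^+ 2 - s ^+ 2) ^+ 2 / 4 <= (t - s) ^+ 2 by nra.
have : (t + s) ^+ 2 <= 4 by nra.
have := sqr_ge0 (t - s); nra.
Qed.

(** For [r] in [0, 1], the mean log-likelihood of a Bernoulli variable of
    parameter [p] when the true parameter is [r]; for [r] = 0 or 1, the
    log-likelihood of an observation. *)
Definition loglik r p := r * ln p + (1 - r) * ln (1 - p).

Lemma loglik_le r c : 0 <= r <= 1 -> 0 < c < 1 ->
  loglik r c <= loglik r r - (r - c) ^+ 2 / 2.
Proof.
move=> /andP[r0 r1] /andP[c0 c1].
have g1 : r * (ln c - ln r) <= c - r - (c - r) ^+ 2 / 4.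
  by apply: gibbs_term; apply/andP; split; lra.
have g2 : (1 - r) * (ln (1 - c) - ln (1 - r)) <=
   (1 - c) - (1 - r) - ((1 - c) - (1 - r)) ^+ 2 / 4.
  by apply: gibbs_term; apply/andP; split; lra.
rewrite /loglik; move: (ln c) (ln r) (ln (1 - c)) (ln (1 - r)) g1 g2.
by move=> A B C D; nra.
Qed.

(** Clipping keeps the logarithms bounded, which the concentration step
    requires, while the parameters of the model may be equal to 0 or 1. *)
Definition clip eta p := Num.max eta (Num.min p (1 - eta)).

Lemma clip_bounds eta p : eta <= 1 / 2 -> eta <= clip eta p <= 1 - eta.
Proof.
move=> e2; rewrite /clip ge_max !le_max lexx ge_min lexx orbT !andbT /=.
lra.
Qed.

Lemma clip_onem eta p : eta <= 1 / 2 -> clip eta (1 - p) = 1 - clip eta p.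
Proof.
move=> e2; rewrite /clip !maxEle !minEle.
do ![case: ifPn]; rewrite -?ltNge; lra.
Qed.

Lemma clip_dist eta p : 0 <= eta -> eta <= 1 / 2 -> 0 <= p <= 1 ->
  `|clip eta p - p| <= eta.
Proof.
move=> e0 e2 /andP[p0 p1]; rewrite ler_norml /clip !maxEle !minEle.
by do ![case: ifPn]; rewrite -?ltNge => *; apply/andP; split; lra.
Qed.

(** Clipping lowers the logarithm only near 1, where -ln (1 - eta) <= 2 eta
    bounds the loss. *)
Lemma ln_clip eta p : 0 < eta -> eta <= 1 / 2 -> 0 < p <= 1 ->
  ln p <= ln (clip eta p) + 2 * eta.
Proof.
move=> e0 e2 /andP[p0 p1].
have /andP[c0 c1] := clip_bounds p e2.
have [pe|pe] := leP p (1 - eta).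
  have : ln p <= ln (clip eta p).
    rewrite ler_ln ?posrE ?(lt_le_trans e0 c0) //.
    by rewrite /clip min_l // le_max lexx orbT.
  lra.
have -> : clip eta p = 1 - eta.
  by rewrite /clip min_r ?max_r ?(ltW pe) //; lra.
have pe0 : 0 < 1 - eta by lra.
have lnp : ln p <= 0 by exact: ln_le0.
have /ln_le_subr1 : 0 < (1 - eta)^-1 by rewrite invr_gt0.
rewrite lnV ?posrE //.
have : (1 - eta)^-1 <= 1 + 2 * eta.
  by rewrite -(ler_pM2r pe0) mulVf ?gt_eqF //; nra.
lra.
Qed.

Lemma lne_le_clip eta p : 0 < eta -> eta <= 1 / 2 -> p <= 1 ->
  (lne p%:E <= (ln (clip eta p) + 2 * eta)%:E)%E.
Proof.
move=> e0 e2 p1; have [p0|p0] := leP p 0.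
  by rewrite le0_lneNy ?lee_fin // leNye.
by rewrite lne_EFin // lee_fin ln_clip // p0.
Qed.

Lemma logit_clip eta p : 0 < eta -> eta <= 1 / 2 ->
  `|ln (clip eta p) - ln (1 - clip eta p)| <= - ln eta.
Proof.
move=> e0 e2; have /andP[c0 c1] := clip_bounds p e2.
have lnc c : eta <= c -> c <= 1 -> ln eta <= ln c /\ ln c <= 0.
  by move=> ec cl; rewrite ln_le0 // ler_ln ?posrE // (lt_le_trans e0).
have [? ?] := lnc _ c0 ltac:(lra).
have [? ?] := lnc (1 - clip eta p) ltac:(lra) ltac:(lra).
by rewrite ler_norml; apply/andP; split; lra.
Qed.

End logarithms.

(** * Bounds on the criterion *)

Section criterion_bounds.
Variables (R : realType) (Q n : nat).
Implicit Types (tau : 'M[R]_(n, Q)) (theta : sbm_parameter R Q).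
Implicit Types (alpha : 'rV[R]_Q) (x : 'M[bool]_n) (z : 'I_n -> 'I_Q).
Implicit Types (F G : 'I_n -> 'I_n -> 'I_Q -> 'I_Q -> R).

Definition pair_sum tau F : R :=
  \sum_i \sum_(j | i != j) \sum_q \sum_l F i j q l * (tau i q * tau j l).

Definition entropy tau (alpha : 'rV[R]_Q) : R :=
  \sum_i \sum_q tau i q * (ln (tau i q) - ln (alpha 0 q)).

Definition hard_labels z : 'M[R]_(n, Q) := \matrix_(i, q) (z i == q)%:R.

Lemma pair_sumD tau F G :
  pair_sum tau (fun i j q l => F i j q l + G i j q l) =
  pair_sum tau F + pair_sum tau G.
Proof.
rewrite /pair_sum -big_split; apply: eq_bigr => i _.
rewrite -big_split; apply: eq_bigr => j _.
rewrite -big_split; apply: eq_bigr => q _.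
by rewrite -big_split; apply: eq_bigr => l _; rewrite mulrDl.
Qed.

Lemma pair_sumZ tau F a :
  pair_sum tau (fun i j q l => a * F i j q l) = a * pair_sum tau F.
Proof.
rewrite /pair_sum mulr_sumr; apply: eq_bigr => i _.
rewrite mulr_sumr; apply: eq_bigr => j _.
rewrite mulr_sumr; apply: eq_bigr => q _.
by rewrite mulr_sumr; apply: eq_bigr => l _; rewrite -[in LHS]mulrA.
Qed.

Lemma pair_sum_le tau F G : tau_set tau ->
  (forall i j q l, i != j -> F i j q l <= G i j q l) ->
  pair_sum tau F <= pair_sum tau G.
Proof.
move=> [t01 _] FG; apply: ler_sum => i _; apply: ler_sum => j ij.
apply: ler_sum => q _; apply: ler_sum => l _; apply: ler_wpM2r; last exact: FG.
by have /andP[? _] := t01 i q; have /andP[? _] := t01 j l; exact: mulr_ge0.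
Qed.

Lemma sum_responsibilities tau i j : tau_set tau ->
  \sum_q \sum_l tau i q * tau j l = 1.
Proof.
move=> [_ t1]; under eq_bigr do rewrite -mulr_sumr t1 mulr1.
exact: t1.
Qed.

(** The products tau_iq tau_jl sum to one over the pairs of groups (q, l), so
    that a sum which does not see the groups does not depend on [tau]. *)
Lemma pair_sum_unlabelled tau (f : 'I_n -> 'I_n -> R) : tau_set tau ->
  pair_sum tau (fun i j _ _ => f i j) = \sum_i \sum_(j | i != j) f i j.
Proof.
move=> tS; rewrite /pair_sum; apply: eq_bigr => i _; apply: eq_bigr => j _.
rewrite -[RHS]mulr1 -(sum_responsibilities i j tS) mulr_sumr.
by apply: eq_bigr => q _; rewrite mulr_sumr.
Qed.

Lemma pair_sum_const tau C : tau_set tau -> 0 <= C ->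
  pair_sum tau (fun _ _ _ _ => C) <= C * n%:R ^+ 2.
Proof.
move=> tS C0; rewrite (pair_sum_unlabelled (fun _ _ => C)) //.
apply: (le_trans (y := \sum_(i < n) \sum_(j < n) C)).
  apply: ler_sum => i _; rewrite [leRHS](bigID (fun j => i != j)) /= lerDl.
  exact: sumr_ge0.
by rewrite !sumr_const card_ord -mulrnA -(mulr_natr C) natrM expr2.
Qed.

Lemma hard_labels_tau_set z : tau_set (hard_labels z).
Proof.
split=> i; first by move=> q; rewrite mxE; case: (_ == _); rewrite ?ler01 lexx.
rewrite (bigD1 (z i)) //= big1 => [|q]; first by rewrite mxE eqxx addr0.
by rewrite mxE eq_sym => /negPf ->.
Qed.

Lemma pair_sum_hard_labels z F :
  pair_sum (hard_labels z) F = \sum_i \sum_(j | i != j) F i j (z i) (z j).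
Proof.
rewrite /pair_sum; apply: eq_bigr => i _; apply: eq_bigr => j _.
rewrite (bigD1 (z i)) //= [X in _ + X]big1 ?addr0 => [|q]; last first.
  by rewrite eq_sym => /negPf zq; rewrite big1 // => l _; rewrite !mxE zq mul0r mulr0.
rewrite (bigD1 (z j)) //= [X in _ + X]big1 ?addr0 => [|q]; last first.
  by rewrite eq_sym => /negPf zq; rewrite !mxE zq !mulr0.
by rewrite !mxE !eqxx !mulr1.
Qed.

Lemma entropy_ge tau alpha : tau_set tau ->
  (forall q, 0 < alpha 0 q <= 1) -> - (n * Q)%:R <= entropy tau alpha.
Proof.
move=> [t01 _] a01; rewrite -lerN2 opprK -sumrN.
apply: (le_trans (y := \sum_(i < n) \sum_(q < Q) 1)); last first.
  by rewrite !sumr_const !card_ord -mulrnA mulnC.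
apply: ler_sum => i _; rewrite -sumrN; apply: ler_sum => q _.
have := @gibbs_term R (tau i q) 1 (t01 i q); rewrite ltr01 lexx ln1 => /(_ isT).
have /andP[? ?] := t01 i q; have /andP[a0 a1] := a01 q.
have : tau i q * ln (alpha 0 q) <= 0 by rewrite mulr_ge0_le0 // ln_le0.
have := sqr_ge0 (1 - tau i q); lra.
Qed.

Lemma entropy_hard_labels z alpha :
  entropy (hard_labels z) alpha = - \sum_i ln (alpha 0 (z i)).
Proof.
rewrite /entropy -sumrN; apply: eq_bigr => i _.
rewrite (bigD1 (z i)) //= [X in _ + X]big1 ?addr0 => [|q]; last first.
  by rewrite eq_sym !mxE => /negPf ->; rewrite mul0r.
by rewrite mxE eqxx ln1 mul1r add0r.
Qed.

Lemma J_entropy tau alpha : tau_set tau -> (forall q, 0 < alpha 0 q) ->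
  (\sum_(i < n) \sum_(q < Q)
     (tau i q)%:E * (lne (tau i q)%:E - lne (alpha 0 q)%:E))%E =
  (entropy tau alpha)%:E.
Proof.
move=> [t01 _] a0; rewrite /entropy -sumEFin; apply: eq_bigr => i _.
rewrite -sumEFin; apply: eq_bigr => q _; rewrite (lne_EFin (a0 q)).
have /andP[] := t01 i q; rewrite le_eqVlt => /predU1P[<- _|t0 _].
  by rewrite mul0e mul0r.
by rewrite lne_EFin.
Qed.

(** Clipping bounds from above even the infinite terms of the criterion, so a
    real-valued upper bound holds whatever the data. *)
Lemma J_le_clip x tau theta eta : tau_set tau -> sbm_valid theta ->
  0 < eta -> eta <= 1 / 2 ->
  (J x tau theta <=
   (pair_sum tau (fun i j q l =>
      loglik (x i j)%:R (clip eta (theta.2 q l)) + 2 * eta)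
    - entropy tau theta.1)%:E)%E.
Proof.
move=> tS [a01 _ p01] e0 e2; rewrite /J J_entropy //; last first.
  by move=> q; have /andP[] := a01 q.
rewrite EFinB leeB // /pair_sum -sumEFin; apply: lee_sum => i _.
rewrite -sumEFin; apply: lee_sum => j _.
rewrite -sumEFin; apply: lee_sum => q _.
rewrite -sumEFin; apply: lee_sum => l _.
have [t01 _] := tS; have /andP[? _] := t01 i q; have /andP[? _] := t01 j l.
rewrite [leRHS]EFinM lee_wpmul2r ?lee_fin ?mulr_ge0 //.
have /andP[pi0 pi1] := p01 q l.
rewrite /loglik; case: (x i j) => /=.
  rewrite subrr mul0e mul1e adde0 mul0r addr0 mul1r; exact: lne_le_clip.
rewrite subr0 mul0e mul1e add0e mul0r add0r mul1r -clip_onem //.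
by apply: lne_le_clip => //; rewrite gerBl.
Qed.

(** Almost surely no edge value has conditional probability zero; this keeps
    the criterion finite at the true parameter. *)
Definition compatible_edges z (pi : 'M[R]_Q) x :=
  forall i j, i != j -> bernoulli_pmf (pi (z i) (z j)) (x i j) != 0.

Lemma J_hard_labels x z theta : sbm_valid theta ->
  compatible_edges z theta.2 x ->
  J x (hard_labels z) theta =
   (pair_sum (hard_labels z) (fun i j q l => loglik (x i j)%:R (theta.2 q l))
    - entropy (hard_labels z) theta.1)%:E.
Proof.
move=> [a01 _ p01] cx; rewrite /J J_entropy //; first last.
- by move=> q; have /andP[] := a01 q.
- exact: hard_labels_tau_set.
rewrite EFinB; congr (_ - _)%E; rewrite /pair_sum -sumEFin; apply: eq_bigr => i _.
rewrite -sumEFin; apply: eq_bigr => j ij.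
rewrite -sumEFin; apply: eq_bigr => q _.
rewrite -sumEFin; apply: eq_bigr => l _.
rewrite !mxE; case: (eqVneq (z i) q) => [<-|_]; last by rewrite !mul0r mule0 mulr0.
case: (eqVneq (z j) l) => [<-|_]; last by rewrite !mulr0 mule0.
rewrite !mulr1 mule1 /loglik; have := cx i j ij.
have /andP[pi0 pi1] := p01 (z i) (z j); rewrite /bernoulli_pmf => px.
have lnx : x i j -> lne (theta.2 (z i) (z j))%:E = (ln (theta.2 (z i) (z j)))%:E.
  by move=> xij; rewrite lne_EFin // lt_neqAle eq_sym pi0 andbT; rewrite xij in px.
have lnNx : ~~ x i j -> lne (1 - theta.2 (z i) (z j))%:E =
    (ln (1 - theta.2 (z i) (z j)))%:E.
  move=> /negPf xij; rewrite lne_EFin // lt_neqAle eq_sym subr_ge0 pi1 andbT.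
  by rewrite xij in px.
case: (x i j) lnx lnNx => [/(_ isT) -> _|_ /(_ isT) ->] /=.
  by rewrite subrr mul0e mul1e adde0 mul0r addr0 mul1r.
by rewrite subr0 mul0e mul1e add0e mul0r add0r mul1r.
Qed.

(** In the criterion, [alpha] enters through the entropy part only; the other
    part cancels as soon as it is finite. *)
Lemma J_le_entropy x tau alpha alpha' (pi : 'M[R]_Q) (r s : R) : tau_set tau ->
  (forall q, 0 < alpha 0 q) -> (forall q, 0 < alpha' 0 q) ->
  (r%:E <= J x tau (alpha, pi))%E -> (J x tau (alpha, pi) <= s%:E)%E ->
  (J x tau (alpha', pi) <= J x tau (alpha, pi))%E ->
  entropy tau alpha <= entropy tau alpha'.
Proof.
move=> tS a0 a0'; rewrite /J !J_entropy //; case: (X in (X - _)%E) => [t|//|//].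
by rewrite -!EFinB !lee_fin => _ _; lra.
Qed.

End criterion_bounds.

(** * From the criterion to the groups *)

Section deterministic_consistency.
Variables (R : realType) (Q n : nat).
Implicit Types (tau : 'M[R]_(n, Q)) (theta : sbm_parameter R Q).
Implicit Types (alpha : 'rV[R]_Q) (pi : 'M[R]_Q).
Implicit Types (x : 'M[bool]_n) (z : 'I_n -> 'I_Q).

Definition edge_dev z pi x i j : R :=
  if i == j then 0 else (x i j)%:R - pi (z i) (z j).

Definition small_bilinear (W : 'I_n -> 'I_n -> R) (eps : R) :=
  forall u v : 'I_n -> R, (forall i, 0 <= u i <= 1) -> (forall i, 0 <= v i <= 1) ->
  `|\sum_i \sum_j W i j * (u i * v j)| <= eps * n%:R ^+ 2.

Definition logit (p : R) := ln p - ln (1 - p).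

Lemma pair_sum_dev_le W tau eps (k : 'I_Q -> 'I_Q -> R) : tau_set tau ->
  (forall i, W i i = 0) -> small_bilinear W eps ->
  `|pair_sum tau (fun i j q l => W i j * k q l)| <=
  (\sum_q \sum_l `|k q l|) * (eps * n%:R ^+ 2).
Proof.
move=> [t01 _] W0 We.
have -> : pair_sum tau (fun i j q l => W i j * k q l) =
    \sum_q \sum_l k q l * \sum_i \sum_j W i j * (tau i q * tau j l).
  under [RHS]eq_bigr => q _ do under eq_bigr => l _ do rewrite mulr_sumr.
  under [RHS]eq_bigr => q _ do rewrite exchange_big.
  rewrite exchange_big; apply: eq_bigr => i _.
  under [RHS]eq_bigr => q _ do under eq_bigr => l _ do rewrite mulr_sumr.
  under [RHS]eq_bigr => q _ do rewrite exchange_big.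
  rewrite exchange_big /= [RHS](bigD1 i) //= [X in X + _]big1 ?add0r.
    rewrite (eq_bigl (fun j => j != i)) => [|j]; last by rewrite eq_sym.
    apply: eq_bigr => j _; apply: eq_bigr => q _; apply: eq_bigr => l _; ring.
  by move=> q _; rewrite big1 // => l _; rewrite W0 mul0r mulr0.
apply: le_trans (ler_norm_sum _ _ _) _; rewrite mulr_suml.
apply: ler_sum => q _; apply: le_trans (ler_norm_sum _ _ _) _.
rewrite mulr_suml; apply: ler_sum => l _; rewrite normrM ler_wpM2l //.
exact: We.
Qed.

(** Because the log-likelihood is affine in the observation, with slope
    [logit]. *)
Lemma pair_sum_loglik tau z pi x (c : 'I_Q -> 'I_Q -> R) :
  pair_sum tau (fun i j q l => loglik (x i j)%:R (c q l)) =
  pair_sum tau (fun i j q l => loglik (pi (z i) (z j)) (c q l)) +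
  pair_sum tau (fun i j q l => edge_dev z pi x i j * logit (c q l)).
Proof.
rewrite -pair_sumD /pair_sum; apply: eq_bigr => i _; apply: eq_bigr => j ij.
apply: eq_bigr => q _; apply: eq_bigr => l _; congr (_ * _).
by rewrite /edge_dev (negPf ij) /loglik /logit; ring.
Qed.

(** In the right-hand side, the terms with [eps] come from the deviation of the
    edges at the estimator and at the true parameter, 2 eta n^2 from the
    clipping, n Q and - n ln gamma from the two entropy parts, and the last
    term from the distance between the clipped pi and pi*. *)
Lemma misclassification_le (gamma eta delta eps : R) x z theta_star theta tau :
  sbm_valid theta_star -> (forall q, gamma <= theta_star.1 0 q) -> 0 < gamma ->
  sbm_valid theta -> tau_set tau ->
  compatible_edges z theta_star.2 x ->
  small_bilinear (edge_dev z theta_star.2 x) eps ->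
  (J x (hard_labels R z) theta_star <= J x tau theta)%E ->
  0 < eta -> eta <= 1 / 2 ->
  (forall q l, `|theta.2 q l - theta_star.2 q l| <= delta) ->
  pair_sum tau (fun i j q l =>
     (theta_star.2 (z i) (z j) - theta_star.2 q l) ^+ 2) <=
  4 * ((\sum_(q < Q) \sum_(l < Q) - ln eta) * (eps * n%:R ^+ 2) +
       (\sum_q \sum_l `|logit (theta_star.2 q l)|) * (eps * n%:R ^+ 2) +
       2 * eta * n%:R ^+ 2 + (n * Q)%:R - n%:R * ln gamma)
  + 2 * (eta + delta) ^+ 2 * n%:R ^+ 2.
Proof.
move=> valS gammaS g0 val tS comp dev Jle e0 e2 dist.
set ps := theta_star.2; have hS := hard_labels_tau_set R z.
have [aS _ psS] := valS; have [a01 _ p01] := val.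
pose c q l := clip eta (theta.2 q l).
pose r i j := ps (z i) (z j).
have r01 i j : 0 <= r i j <= 1 by exact: psS.
have c01 q l : 0 < c q l < 1.
  by have /andP[? ?] := clip_bounds (theta.2 q l) e2; apply/andP; split; rewrite /c; lra.
have Wii i : edge_dev z ps x i i = 0 by rewrite /edge_dev eqxx.
pose e_star := entropy (hard_labels R z) theta_star.1.
pose e_tau := entropy tau theta.1.
pose LS := pair_sum (hard_labels R z) (fun i j q l => loglik (r i j) (ps q l)).
pose DS := pair_sum (hard_labels R z)
  (fun i j q l => edge_dev z ps x i j * logit (ps q l)).
pose LT := pair_sum tau (fun i j q l => loglik (r i j) (c q l)).
pose DT := pair_sum tau (fun i j q l => edge_dev z ps x i j * logit (c q l)).
pose Eta := pair_sum tau (fun _ _ _ _ => 2 * eta).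
(* S stands for the true labels and parameter, T for the estimator; L is a
   mean log-likelihood and D the deviation of the observed one from it. *)
have crit : LS + DS - e_star <= LT + DT + Eta - e_tau.
  have := le_trans Jle (J_le_clip x tS val e0 e2).
  rewrite J_hard_labels // lee_fin.
  rewrite /LS /DS -(pair_sum_loglik _ z ps x (fun q l => ps q l)).
  by rewrite /LT /DT -(pair_sum_loglik _ z ps x c) -pair_sumD.
have leDS : `|DS| <= (\sum_q \sum_l `|logit (ps q l)|) * (eps * n%:R ^+ 2).
  exact: (pair_sum_dev_le (fun q l => logit (ps q l)) hS Wii dev).
have leDT : `|DT| <= (\sum_(q < Q) \sum_(l < Q) - ln eta) * (eps * n%:R ^+ 2).
  apply: le_trans (pair_sum_dev_le (fun q l => logit (c q l)) tS Wii dev) _.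
  apply: ler_wpM2r.
    by apply: le_trans (normr_ge0 _) (dev (fun=> 0) (fun=> 0) _ _) => i;
      rewrite lexx ler01.
  by apply: ler_sum => q _; apply: ler_sum => l _; exact: logit_clip.
have leEta : Eta <= 2 * eta * n%:R ^+ 2 by apply: pair_sum_const => //; lra.
have le_tau : - (n * Q)%:R <= e_tau.
  by apply: entropy_ge => // q; have /andP[a0 a1] := a01 q; rewrite a0 ltW.
have le_star : e_star <= - (n%:R * ln gamma).
  rewrite /e_star entropy_hard_labels lerN2 mulr_natl -[n in _ *+ n]card_ord.
  rewrite -sumr_const.
  apply: ler_sum => i _; have /andP[? _] := aS (z i).
  by rewrite ler_ln ?posrE.
(* The value at the truth does not depend on the groups, so it can be
   written with the weights of tau and compared with LT term by term. *)
have selfE : LS = pair_sum tau (fun i j _ _ => loglik (r i j) (r i j)).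
  by rewrite pair_sum_unlabelled // /LS pair_sum_hard_labels.
(* A square (u + v)^2 is at most 2 u^2 + 2 v^2: here u is the distance
   to the clipped parameter, bounded by a divergence, and v the distance from
   the latter to pi*. *)
have quad : pair_sum tau (fun i j q l => (r i j - ps q l) ^+ 2) <=
    4 * (LS - LT) + 2 * (eta + delta) ^+ 2 * n%:R ^+ 2.
  apply: (le_trans (y := pair_sum tau (fun i j q l =>
    (4 * loglik (r i j) (r i j) + (- 4) * loglik (r i j) (c q l)) +
    2 * (eta + delta) ^+ 2))).
    apply: pair_sum_le => // i j q l _.
    have := loglik_le (r01 i j) (c01 q l).
    have := clip_dist (ltW e0) e2 (p01 q l); have := dist q l.
    rewrite -/(c q l) -/(ps q l) !ler_norml => /andP[? ?] /andP[? ?].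
    have : (c q l - ps q l) ^+ 2 <= (eta + delta) ^+ 2 by nra.
    have := sqr_ge0 ((r i j - c q l) - (c q l - ps q l)); nra.
  rewrite !pair_sumD (pair_sumZ _ _ 4) (pair_sumZ _ _ (- 4)) -selfE -/LT.
  have : pair_sum tau (fun _ _ _ _ => 2 * (eta + delta) ^+ 2) <=
     2 * (eta + delta) ^+ 2 * n%:R ^+ 2.
    by apply: pair_sum_const => //; rewrite mulr_ge0 ?sqr_ge0.
  lra.
apply: le_trans quad _.
move: leDS leDT; rewrite !ler_norml => /andP[? ?] /andP[? ?]; lra.
Qed.

(** The n diagonal pairs, absent from the criterion, are restored to factor
    the sum over pairs of nodes into sums over single nodes. *)
Lemma misclassification_full z pi tau : tau_set tau ->
  (forall q l, 0 <= pi q l <= 1) ->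
  \sum_i \sum_j \sum_q \sum_l
    (pi (z i) (z j) - pi q l) ^+ 2 * (tau i q * tau j l) <=
  pair_sum tau (fun i j q l => (pi (z i) (z j) - pi q l) ^+ 2) + n%:R.
Proof.
move=> tS p01; rewrite -[n in n%:R]card_ord -sumr_const -big_split /=.
apply: ler_sum => i _; rewrite (bigD1 i) //= addrC; apply: lerD.
  rewrite le_eqVlt; apply/orP; left; apply/eqP.
  by apply: eq_bigl => j; rewrite eq_sym.
rewrite -(sum_responsibilities i i tS); apply: ler_sum => q _.
apply: ler_sum => l _; rewrite -[leRHS]mul1r; have [t01 _] := tS.
have /andP[? _] := t01 i q; have /andP[? _] := t01 i l.
apply: ler_wpM2r; first exact: mulr_ge0.
have /andP[? ?] := p01 (z i) (z i); have /andP[? ?] := p01 q l; nra.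
Qed.

Definition label_share tau z (q a : 'I_Q) : R :=
  n%:R^-1 * \sum_(i | z i == a) tau i q.

Lemma label_share_ge0 tau z q a : tau_set tau -> 0 <= label_share tau z q a.
Proof.
move=> [t01 _]; rewrite mulr_ge0 ?invr_ge0 // sumr_ge0 // => i _.
by have /andP[] := t01 i q.
Qed.

Lemma label_share_sum tau z a : tau_set tau ->
  \sum_q label_share tau z q a = n%:R^-1 * \sum_i (z i == a)%:R.
Proof.
move=> [_ t1]; rewrite -mulr_sumr exchange_big /= big_mkcond /=; congr (_ * _).
by apply: eq_bigr => i _; case: eqP => // _; rewrite t1.
Qed.

Lemma label_share_total tau z q :
  \sum_a label_share tau z q a = n%:R^-1 * \sum_i tau i q.
Proof. by rewrite -mulr_sumr [in RHS](partition_big z xpredT). Qed.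

Lemma label_share_product tau z pi (rho : R) a b q l : tau_set tau ->
  (forall q l, 0 <= pi q l <= 1) -> (0 < n)%N ->
  pair_sum tau (fun i j q l => (pi (z i) (z j) - pi q l) ^+ 2) + n%:R
    <= rho * n%:R ^+ 2 ->
  label_share tau z q a * label_share tau z l b * (pi a b - pi q l) ^+ 2 <= rho.
Proof.
move=> tS p01 n0 le_rho; have [t01 _] := tS.
have n1 : 0 < n%:R :> R by rewrite ltr0n.
rewrite -(@ler_pM2r _ (n%:R ^+ 2)) ?exprn_gt0 //.
apply: le_trans le_rho; apply: le_trans (misclassification_full z tS p01).
have -> : label_share tau z q a * label_share tau z l b * (pi a b - pi q l) ^+ 2
    * n%:R ^+ 2 =
    \sum_(i | z i == a) \sum_(j | z j == b)
      (pi (z i) (z j) - pi q l) ^+ 2 * (tau i q * tau j l).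
  rewrite /label_share; transitivity ((pi a b - pi q l) ^+ 2 *
     ((\sum_(i | z i == a) tau i q) * (\sum_(j | z j == b) tau j l))).
    by field; rewrite gt_eqF.
  rewrite mulr_suml mulr_sumr; apply: eq_bigr => i /eqP ->.
  by rewrite !mulr_sumr; apply: eq_bigr => j /eqP ->.
have g0 i j q' l' : 0 <= (pi (z i) (z j) - pi q' l') ^+ 2 * (tau i q' * tau j l').
  have /andP[? _] := t01 i q'; have /andP[? _] := t01 j l'.
  by rewrite mulr_ge0 ?sqr_ge0 ?mulr_ge0.
rewrite [leRHS](bigID (fun i => z i == a)) /= -[leLHS]addr0; apply: lerD; last first.
  by do 4!(apply: sumr_ge0 => ? _).
apply: ler_sum => i _.
rewrite [leRHS](bigID (fun j => z j == b)) /= -[leLHS]addr0; apply: lerD; last first.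
  by do 3!(apply: sumr_ge0 => ? _).
apply: ler_sum => j _; rewrite (bigD1 q) //= (bigD1 l) //= -addrA lerDl addr_ge0 //.
  exact: sumr_ge0.
by do 2!(apply: sumr_ge0 => ? _).
Qed.

End deterministic_consistency.

(** Sending [a] to the [q] that maximises [T q a] >= g / Q gives a map [s];
    since [rho] is below the smallest possible nonzero value, [pi] is invariant
    under [s], and (A1) makes [s] injective.  If [q <> s a], (A1) gives some
    [l = s b] that tells [q] from [s a]; as [T (s b) b] is large, [T q a] must
    be small. *)
Lemma near_permutation (R : realType) Q (T : 'I_Q -> 'I_Q -> R) (pi : 'M[R]_Q)
    (g rho kappa : R) : (0 < Q)%N -> 0 < g -> 0 < kappa ->
  (forall q a, 0 <= T q a) -> (forall a, g <= \sum_q T q a) -> condA1 pi ->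
  (forall a b q l, pi a b != pi q l -> kappa <= (pi a b - pi q l) ^+ 2) ->
  (forall a b q l, T q a * T l b * (pi a b - pi q l) ^+ 2 <= rho) ->
  rho < (g / Q%:R) ^+ 2 * kappa ->
  exists2 s : 'S_Q, relabel_pi s pi = pi &
    forall a q, q != s a -> T q a * (g / Q%:R * kappa) <= rho.
Proof.
move=> Q0 g0 k0 T0 Tg A1 gap prod rho_lt.
have QR0 : 0 < Q%:R :> R by rewrite ltr0n.
have m0 : 0 < g / Q%:R by rewrite divr_gt0.
pose f a := [arg max_(q > a) T q a]%O.
have fP a : g / Q%:R <= T (f a) a.
  rewrite /f; case: arg_maxP => // q _ q_max.
  rewrite ler_pdivrMr //; apply: le_trans (Tg a) _.
  rewrite mulr_natr -[Q in _ *+ Q]card_ord -sumr_const.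
  by apply: ler_sum => p _; exact: q_max.
have fpi a b : pi a b = pi (f a) (f b).
  apply/eqP; move: rho_lt; apply: contraLR => ne; rewrite -leNgt.
  apply: le_trans (prod a b (f a) (f b)).
  have ? := gap _ _ _ _ ne; have ? := fP a; have ? := fP b.
  apply: ler_pM; rewrite ?exprn_ge0 ?(ltW m0) ?(ltW k0) // expr2.
  by apply: ler_pM; rewrite ?(ltW m0).
have f_inj : injective f.
  move=> a a' faa; apply/eqP; apply: contraT => /A1 [l] [].
  - by rewrite [pi a l]fpi [pi a' l]fpi faa.
  - by rewrite [pi l a]fpi [pi l a']fpi faa.
exists (perm f_inj); first by apply/matrixP => a b; rewrite mxE !permE -fpi.
move=> a q; rewrite permE => qfa.
have [l] := A1 _ _ qfa.
have [b ->] : exists b, l = f b by exists (invF f_inj l); rewrite f_invF.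
have bound (A B K : R) : 0 <= A -> g / Q%:R <= B -> kappa <= K ->
    A * B * K <= rho -> A * (g / Q%:R * kappa) <= rho.
  move=> A0 Bm Kk; apply: le_trans; rewrite -[leRHS]mulrA ler_wpM2l //.
  by apply: ler_pM; rewrite ?(ltW m0) ?(ltW k0).
case=> /eqP ne.
- apply: (bound _ (T (f b) b) ((pi a b - pi q (f b)) ^+ 2)) => //.
  by apply: gap; rewrite fpi eq_sym.
- apply: (bound _ (T (f b) b) ((pi b a - pi (f b) q) ^+ 2)) => //.
    by apply: gap; rewrite fpi eq_sym.
  by rewrite [X in X * _]mulrC; exact: prod.
Qed.

(** If m is the vector of group means of [tau], the hypothesis on entropies
    says that m * (ln beta - ln alpha) sums to at most 0.  Replacing m by [beta]
    costs at most Q xi (- ln gamma), and what remains is the Kullback-Leibler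
    divergence of [alpha] from [beta], which controls squared distances. *)
Lemma entropy_argmax_dist (R : realType) Q n (tau : 'M[R]_(n, Q))
    (alpha beta : 'rV[R]_Q) (gamma xi : R) : (0 < n)%N -> 0 < gamma ->
  (forall q, gamma <= alpha 0 q <= 1) -> (forall q, gamma <= beta 0 q <= 1) ->
  \sum_q alpha 0 q = 1 -> \sum_q beta 0 q = 1 ->
  (forall q, `|n%:R^-1 * (\sum_i tau i q) - beta 0 q| <= xi) ->
  entropy tau alpha <= entropy tau beta ->
  forall q, (alpha 0 q - beta 0 q) ^+ 2 <= 4 * (Q%:R * (xi * - ln gamma)).
Proof.
move=> n0 g0 ag bg a1 b1 xiP ent q.
have n1 : 0 < n%:R :> R by rewrite ltr0n.
pose m q := n%:R^-1 * \sum_i tau i q.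
have crit : \sum_q m q * (ln (beta 0 q) - ln (alpha 0 q)) <= 0.
  have -> : \sum_q m q * (ln (beta 0 q) - ln (alpha 0 q)) =
      n%:R^-1 * (entropy tau alpha - entropy tau beta).
    rewrite /entropy -sumrB mulr_sumr.
    under eq_bigr => p _ do rewrite /m -mulrA mulr_suml mulr_sumr.
    rewrite exchange_big; apply: eq_bigr => i _ /=.
    rewrite -sumrB mulr_sumr; apply: eq_bigr => p _; ring.
  by rewrite mulr_ge0_le0 ?invr_ge0 ?subr_le0.
have lnb (a : 'rV[R]_Q) p : (forall q, gamma <= a 0 q <= 1) ->
    ln gamma <= ln (a 0 p) /\ ln (a 0 p) <= 0.
  move=> /(_ p) /andP[h1 h2]; rewrite ln_le0 // ler_ln ?posrE //.
  exact: lt_le_trans h1.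
have kl : \sum_p (alpha 0 p - beta 0 p) ^+ 2 / 4 <=
    \sum_p beta 0 p * (ln (beta 0 p) - ln (alpha 0 p)).
  apply: (le_trans (y := \sum_p (beta 0 p * (ln (beta 0 p) - ln (alpha 0 p)) +
     (alpha 0 p - beta 0 p)))); last first.
    by rewrite big_split /= [X in _ + X]sumrB a1 b1 subrr addr0.
  apply: ler_sum => p _; have /andP[? ?] := ag p; have /andP[? ?] := bg p.
  have := @gibbs_term R (beta 0 p) (alpha 0 p).
  have -> : 0 <= beta 0 p <= 1 by apply/andP; split; lra.
  have -> : 0 < alpha 0 p <= 1 by apply/andP; split; lra.
  move=> /(_ isT isT); lra.
have devi : \sum_p beta 0 p * (ln (beta 0 p) - ln (alpha 0 p)) <=
    Q%:R * (xi * - ln gamma).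
  apply: (le_trans (y := \sum_p (beta 0 p - m p) *
      (ln (beta 0 p) - ln (alpha 0 p)))).
    rewrite -subr_ge0 -sumrB; move: crit; rewrite -oppr_ge0 -sumrN.
    by congr (0 <= _); apply: eq_bigr => p _; ring.
  rewrite mulr_natl -[Q in _ *+ Q]card_ord -sumr_const; apply: ler_sum => p _.
  apply: le_trans (ler_norm _) _; rewrite normrM.
  have [? ?] := lnb _ p ag; have [? ?] := lnb _ p bg.
  apply: ler_pM => //; first by rewrite distrC; exact: xiP.
  by rewrite ler_norml; apply/andP; split; lra.
have : (alpha 0 q - beta 0 q) ^+ 2 / 4 <= \sum_p (alpha 0 p - beta 0 p) ^+ 2 / 4.
  by rewrite [leRHS](bigD1 q) //= lerDl sumr_ge0 // => p _; rewrite divr_ge0 ?sqr_ge0.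
by have := le_trans kl devi; lra.
Qed.

(** * The estimator on a typical graph *)

Section estimator.
Variables (R : realType) (Q : nat) (gamma zeta : R).
Implicit Types (theta : sbm_parameter R Q) (alpha : 'rV[R]_Q) (pi : 'M[R]_Q).

Lemma squared_gap pi : exists2 kappa : R, 0 < kappa &
  forall a b q l, pi a b != pi q l -> kappa <= (pi a b - pi q l) ^+ 2.
Proof.
pose F (u : ('I_Q * 'I_Q) * ('I_Q * 'I_Q)) := pi u.1.1 u.1.2 - pi u.2.1 u.2.2.
exists (\big[Num.min/1]_(u | F u != 0) F u ^+ 2).
  by apply: lt_bigmin => // u u0; rewrite exprn_even_gt0 //= u0.
move=> a b q l ne; apply: (@bigmin_le_cond _ _ _ _ ((a, b), (q, l))).
by rewrite /F /= subr_eq0.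
Qed.

Lemma admissible_relabel s alpha alpha' pi pi' :
  admissible gamma zeta (alpha, pi) -> admissible gamma zeta (alpha', pi') ->
  admissible gamma zeta (relabel_alpha s alpha, pi').
Proof.
move=> [[a01 a1 _] _ _ A3] [[_ _ p01] A1 A2 _]; split => //; last first.
  by move=> q; rewrite mxE; exact: A3.
split => //; first by move=> q; rewrite mxE; exact: a01.
rewrite -[RHS]a1 [RHS](reindex_inj (@perm_inj _ s)) /=.
by apply: eq_bigr => q _; rewrite mxE.
Qed.

(** Both means contain the share [T (s a) a]; they differ by the shares of
    other labels in group [s a], and of label [a] in other groups. *)
Lemma label_mean_le n (tau : 'M[R]_(n, Q)) (z : 'I_n -> 'I_Q) (s : 'S_Q) r a :
  tau_set tau -> 0 <= r ->
  (forall a q, q != s a -> label_share tau z q a <= r) ->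
  `|n%:R^-1 * (\sum_i tau i (s a)) - n%:R^-1 * (\sum_i (z i == a)%:R)| <= Q%:R * r.
Proof.
move=> tS r0 sP; rewrite -(label_share_total tau z) -(label_share_sum z a tS).
rewrite (bigD1 a) //= [X in _ - X](bigD1 (s a)) //= opprD addrACA subrr add0r.
have sum_le (b : 'I_Q) (F : 'I_Q -> R) : (forall q, 0 <= F q) ->
    (forall q, q != b -> F q <= r) ->
    0 <= \sum_(q | q != b) F q /\ \sum_(q | q != b) F q <= Q%:R * r.
  move=> F0 Fr; split; first exact: sumr_ge0.
  apply: (le_trans (y := \sum_(q < Q) r)); last first.
    by rewrite sumr_const card_ord mulr_natl.
  rewrite [leRHS](bigD1 b) //= -[leLHS]add0r lerD //.
  by apply: ler_sum => q; exact: Fr.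
have [? ?] : 0 <= \sum_(b | b != a) label_share tau z (s a) b /\
    \sum_(b | b != a) label_share tau z (s a) b <= Q%:R * r.
  apply: sum_le => b; first exact: label_share_ge0.
  by move=> ba; apply: sP; rewrite (inj_eq perm_inj) eq_sym.
have [? ?] := sum_le (s a) (fun q => label_share tau z q a)
  (fun q => label_share_ge0 z q a tS) (sP a).
by rewrite ler_norml; apply/andP; split; lra.
Qed.


(** All the randomness is confined to the typicality hypotheses on the edges
    and labels and to the distance from pi to pi*.  The thresholds depend
    neither on the graph nor on its size, so that one bound on the probability
    of these hypotheses suffices. *)
Lemma estimator_close theta_star e : (0 < Q)%N -> 0 < gamma ->
  admissible gamma zeta theta_star -> 0 < e ->
  exists eps delta : R, exists N : nat, [/\ 0 < eps, 0 < delta &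
  forall n (x : 'M[bool]_n) (z : 'I_n -> 'I_Q) tau_hat theta, (N <= n)%N ->
    is_tau_hat gamma zeta tau_hat ->
    compatible_edges z theta_star.2 x ->
    small_bilinear (edge_dev z theta_star.2 x) eps ->
    (forall a, `|n%:R^-1 * (\sum_i (z i == a)%:R) - theta_star.1 0 a| <= eps) ->
    (forall q l, `|theta.2 q l - theta_star.2 q l| <= delta) ->
    is_variational_estimator gamma zeta tau_hat x theta ->
    exists2 s : 'S_Q, relabel_pi s theta_star.2 = theta_star.2 &
      forall a, `|theta.1 0 (s a) - theta_star.1 0 a| <= e].
Proof.
move=> Q0 g0 admS e0; have [valS A1S A2S A3S] := admS.
have QR0 : 0 < Q%:R :> R by rewrite ltr0n.
have [aS aS1 pS] := valS.
have [kappa k0 gap] := squared_gap theta_star.2.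
set L := - ln gamma.
have g1 : gamma <= 1 / 2.
  by have /andP[? ?] := A3S (Ordinal Q0); lra.
have L0 : 0 <= L by rewrite oppr_ge0 ln_le0 //; lra.
(* The constants are chosen backwards: xi is the error allowed on the group
   means, rho the misclassification that guarantees it, eta the clipping
   level for rho, and eps the fluctuation allowed once eta is fixed. *)
have [xi xi0 xiE] : exists2 xi : R, 0 < xi & e ^+ 2 = 4 * (Q%:R * (xi * (L + 1))).
  exists (e ^+ 2 / (4 * Q%:R * (L + 1))).
    by rewrite divr_gt0 ?exprn_gt0 // !mulr_gt0 //; lra.
  by field; apply/andP; split; rewrite gt_eqF //; lra.
pose h := gamma / 2 / Q%:R.
have h0 : 0 < h by rewrite !divr_gt0.
pose rho := Num.min (h ^+ 2 * kappa / 2) (xi / 2 / Q%:R * (h * kappa)).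
have rho0 : 0 < rho.
  rewrite lt_min; apply/andP; split.
    by rewrite divr_gt0 // mulr_gt0 // exprn_gt0.
  by apply: mulr_gt0; [rewrite !divr_gt0|rewrite mulr_gt0].
have rho1 : rho < h ^+ 2 * kappa.
  have : rho <= h ^+ 2 * kappa / 2 by rewrite ge_min lexx.
  have : 0 < h ^+ 2 * kappa by rewrite mulr_gt0 ?exprn_gt0.
  lra.
have rho2 : rho <= xi / 2 / Q%:R * (h * kappa) by rewrite ge_min lexx orbT.
pose eta := Num.min (1 / 2) (rho / 48).
have eta0 : 0 < eta by rewrite lt_min; apply/andP; split; lra.
have eta1 : eta <= 1 / 2 by rewrite ge_min lexx.
have eta2 : eta <= rho / 48 by rewrite ge_min lexx orbT.
pose K1 := \sum_(q < Q) \sum_(l < Q) - ln eta.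
pose K2 := \sum_q \sum_l `|logit (theta_star.2 q l)|.
have K1_ge0 : 0 <= K1.
  by do 2!(apply: sumr_ge0 => ? _); rewrite oppr_ge0 ln_le0 //; lra.
have K2_ge0 : 0 <= K2 by do 2!(apply: sumr_ge0 => ? _).
pose C := 4 * Q%:R + 4 * L + 1.
have C0 : 0 < C by rewrite /C; lra.
pose eps := Num.min (Num.min (xi / 2) (gamma / 2)) (rho / (16 * (K1 + K2 + 1))).
have eps0 : 0 < eps.
  by rewrite !lt_min !divr_gt0 // mulr_gt0 //; lra.
have eps1 : eps <= xi / 2 by rewrite !ge_min lexx.
have eps2 : eps <= gamma / 2 by rewrite !ge_min lexx orbT.
have eps3 : 16 * (K1 + K2) * eps <= rho.
  have : eps <= rho / (16 * (K1 + K2 + 1)) by rewrite !ge_min lexx !orbT.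
  rewrite ler_pdivlMr; last by rewrite mulr_gt0 //; lra.
  by nra.
pose N := (Num.truncn (4 * C / rho)).+1.
exists eps, eta, N; split => // n x z tau_hat theta nN htau comp dev count dist est.
have n1 : 0 < n%:R :> R by rewrite ltr0n (leq_trans _ nN).
have n0 : (0 < n)%N by rewrite -(ltr0n R).
have CN : C * n%:R <= rho / 4 * n%:R ^+ 2.
  have : 4 * C / rho <= n%:R.
    apply: le_trans (ltW (truncnS_gt _)) _; by rewrite ler_nat.
  by rewrite ler_pdivrMr // expr2 => ?; nra.
have [adm opt] := est; have [val _ _ A3] := adm.
have [a01 a1 p01] := val.
pose tau := tau_hat n x theta; have [tS _] := htau n x theta adm.
have Jle : (J x (hard_labels R z) theta_star <= J x tau theta)%E.
  apply: le_trans (opt _ admS).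
  by have [_] := htau n x theta_star admS; apply; exact: hard_labels_tau_set.
have mis := misclassification_le valS (fun q => (andP (A3S q)).1) g0 val tS
  comp dev Jle eta0 eta1 dist.
have mis_rho : pair_sum tau (fun i j q l =>
    (theta_star.2 (z i) (z j) - theta_star.2 q l) ^+ 2) + n%:R <= rho * n%:R ^+ 2.
  have n2 : 0 < n%:R ^+ 2 :> R by rewrite exprn_gt0.
  apply: le_trans (lerD mis (lexx _)) _; rewrite -/K1 -/K2 natrM.
  have t1 : 16 * (K1 + K2) * eps * n%:R ^+ 2 <= rho * n%:R ^+ 2 by rewrite ler_pM2r.
  have t2 : eta * n%:R ^+ 2 <= rho / 48 * n%:R ^+ 2 by rewrite ler_pM2r.
  have t3 : eta ^+ 2 * n%:R ^+ 2 <= eta / 2 * n%:R ^+ 2 by rewrite ler_pM2r //; nra.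
  have -> : eta + eta = 2 * eta by ring.
  rewrite exprMn; move: CN; rewrite /C /L; nra.
have [s s_pi sT] : exists2 s : 'S_Q, relabel_pi s theta_star.2 = theta_star.2 &
    forall a q, q != s a -> label_share tau z q a * (h * kappa) <= rho.
  apply: near_permutation => //.
  - by rewrite divr_gt0.
  - by move=> q a; exact: label_share_ge0.
  - move=> a; rewrite (label_share_sum z a tS); have := count a.
    by have /andP[? _] := A3S a; rewrite ler_norml => /andP[? _]; lra.
  - by move=> a b q l; apply: label_share_product.
have share_le a q : q != s a -> label_share tau z q a <= xi / 2 / Q%:R.
  move=> qsa; have hk : 0 < h * kappa by rewrite mulr_gt0.
  by rewrite -(ler_pM2r hk); exact: le_trans (sT _ _ qsa) rho2.
have mean_le a : `|n%:R^-1 * (\sum_i tau i (s a)) - theta_star.1 0 a| <= xi.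
  have r0 : 0 <= xi / 2 / Q%:R by rewrite divr_ge0 ?ltW // divr_gt0.
  have := label_mean_le a tS r0 share_le; have := count a.
  have -> : Q%:R * (xi / 2 / Q%:R) = xi / 2 by field; rewrite gt_eqF.
  by rewrite !ler_norml => /andP[? ?] /andP[? ?]; apply/andP; split; lra.
exists s => // a.
pose beta := relabel_alpha s^-1 theta_star.1.
have adm' : admissible gamma zeta (beta, theta.2).
  apply: (@admissible_relabel _ _ theta.1 theta_star.2).
    by rewrite -(surjective_pairing theta_star).
  by rewrite -(surjective_pairing theta).
(* The relabelled alpha* with the estimated pi is admissible, hence a
   competitor of the estimator at the same tau. *)
have ent : entropy tau theta.1 <= entropy tau beta.
  have a0 q : 0 < theta.1 0 q by have /andP[] := a01 q.
  have b0 q : 0 < beta 0 q by rewrite mxE; have /andP[] := aS ((s^-1)%g q).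
  move: Jle (J_le_clip x tS val eta0 eta1); rewrite J_hard_labels // => Jlo Jup.
  have JE : J x tau theta = J x tau (theta.1, theta.2).
    by rewrite -surjective_pairing.
  rewrite JE in Jlo Jup.
  apply: (J_le_entropy tS a0 b0 Jlo Jup).
  rewrite -surjective_pairing; apply: le_trans (opt _ adm').
  by have [_] := htau n x _ adm'; apply.
have le1 (al : 'rV[R]_Q) : condA3 gamma al -> forall q, gamma <= al 0 q <= 1.
  by move=> A q; have /andP[? ?] := A q; apply/andP; split; lra.
have [_ _ _ A3'] := adm'; have [[_ beta1 _] _ _ _] := adm'.
have := @entropy_argmax_dist R Q n tau theta.1 beta gamma xi n0 g0
  (le1 _ A3) (le1 _ A3') a1 beta1 _ ent (s a).
rewrite -/L mxE permK => close.
rewrite -(@ler_pXn2r _ 2) ?nnegrE ?normr_ge0 ?(ltW e0) // real_normK ?num_real //.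
apply: le_trans (close _) _.
  by move=> q; rewrite mxE -[q in \sum_i tau i q](permKV s); exact: mean_le.
rewrite xiE; rewrite !ler_pM2l //; lra.
Qed.

End estimator.

(** * Probability of a typical graph *)

Section random_graph.
Context {d : measure_display} {T : measurableType d} {R : realType}.
Variables (P : probability T R) (Q : nat) (alpha : 'rV[R]_Q) (pi : 'M[R]_Q).
Variables (Z : nat -> T -> 'I_Q) (X : nat -> nat -> T -> bool).
Hypotheses (Q_gt0 : (0 < Q)%N) (alpha01 : forall q, 0 < alpha 0 q < 1).
Hypotheses (alpha1 : \sum_q alpha 0 q = 1) (pi01 : forall q l, 0 <= pi q l <= 1).
Hypothesis modelZX : sbm P (alpha, pi) Z X.

Section fixed_size.
Variable n : nat.

Definition labels w : {ffun 'I_n -> 'I_Q} := [ffun i : 'I_n => Z i w].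
Definition edges w : {ffun 'I_n * 'I_n -> bool} := [ffun e : 'I_n * 'I_n => X e.1 e.2 w].

Definition label_weight (i : 'I_n) q : R := alpha 0 q.
(** The diagonal, where the graph has no edge, carries the law concentrated on
    [false], so that all pairs of nodes are treated alike. *)
Definition edge_weight (z : {ffun 'I_n -> 'I_Q}) (e : 'I_n * 'I_n) (b : bool) : R :=
  if e.1 == e.2 then (~~ b)%:R else bernoulli_pmf (pi (z e.1) (z e.2)) b.

Definition label_event (z : {ffun 'I_n -> 'I_Q}) :=
  [set w | forall i : 'I_n, Z i w = z i].
Definition edge_event (x : {ffun 'I_n * 'I_n -> bool}) :=
  [set w | forall i j : 'I_n, i != j -> X i j w = x (i, j)].

Lemma measurable_label_event z : measurable (label_event z).
Proof.
have [[mZ _ _] _] := modelZX.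
have -> : label_event z = \bigcap_(i : 'I_n) (Z i @^-1` [set z i]).
  by apply/seteqP; split => [w h i _|w h i]; exact: h.
by apply: fin_bigcap_measurable => // i _; exact: mZ.
Qed.

Lemma measurable_edge_event x : measurable (edge_event x).
Proof.
have [_ [mX _ _]] := modelZX.
have mXb i j b : measurable (X i j @^-1` [set b]).
  case: b; first exact: mX.
  rewrite (_ : _ @^-1` _ = ~` (X i j @^-1` [set true])).
    by apply: measurableC; exact: mX.
  by apply/seteqP; split => w /=; case: (X i j w).
have -> : edge_event x = \bigcap_(e in [set e : 'I_n * 'I_n | e.1 != e.2])
    (X e.1 e.2 @^-1` [set x e]).
  apply/seteqP; split => [w h [i j] /= ij|w h i j ij]; first exact: h.
  by apply: (h (i, j)).
by apply: fin_bigcap_measurable => [|e _]; [exact: finite_finset|exact: mXb].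
Qed.

Lemma prob_label_event z : P (label_event z) = (\prod_i label_weight i (z i))%:E.
Proof.
have [[_ PZ indep] _] := modelZX.
pose z' k := oapp z (Ordinal Q_gt0) (insub k : option 'I_n).
have z'E (i : 'I_n) : z' i = z i by rewrite /z' valK.
have -> : label_event z = \bigcap_(k in [set` iota 0 n]) (Z k @^-1` [set z' k]).
  apply/seteqP; split => [w h k /=|w h i].
    by rewrite mem_iota add0n => kn; rewrite (h (Ordinal kn)) -(z'E (Ordinal kn)).
  by rewrite -z'E; apply: (h i); rewrite /= mem_iota add0n /= ltn_ord.
rewrite indep ?iota_uniq // -prodEFin -[n in iota 0 n]subn0 -/(index_iota 0 n).
by rewrite big_mkord; apply: eq_bigr => i _; rewrite PZ z'E.
Qed.

Lemma prob_label_edge_event z (x : {ffun 'I_n * 'I_n -> bool}) :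
  (forall i, x (i, i) = false) ->
  P (label_event z `&` edge_event x) =
  ((\prod_i label_weight i (z i)) * \prod_e edge_weight z e (x e))%:E.
Proof.
move=> xd; have [_ [_ _ cond]] := modelZX.
have := cond n z (\matrix_(i, j) x (i, j)); rewrite /= => condzx.
have -> : edge_event x =
    [set w | forall i j : 'I_n, i != j -> X i j w = (\matrix_(i, j) x (i, j)) i j].
  by apply/seteqP; split => w h i j ij; move: (h i j ij); rewrite mxE.
rewrite condzx prob_label_event EFinM; congr (_ * _%:E)%E.
rewrite [RHS](eq_bigr (fun e => edge_weight z (e.1, e.2) (x (e.1, e.2)))); last by case.
rewrite -(pair_bigA _ (fun i j => edge_weight z (i, j) (x (i, j)))) /=.
apply: eq_bigr => i _; rewrite [RHS](bigD1 i) //= {1}/edge_weight eqxx xd mul1r.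
rewrite (eq_bigl (fun j => j != i)) => [|j]; last by rewrite eq_sym.
by apply: eq_bigr => j ji; rewrite /edge_weight /= eq_sym (negPf ji) mxE.
Qed.

Definition model_mean (G : {ffun 'I_n -> 'I_Q} ->
    {ffun 'I_n * 'I_n -> bool} -> R) : R :=
  product_mean label_weight (fun z => product_mean (edge_weight z) (G z)).

Lemma label_weight_ge0 i q : 0 <= label_weight i q.
Proof. by rewrite ltW //; have /andP[] := alpha01 q. Qed.

Lemma edge_weight_ge0 z e b : 0 <= edge_weight z e b.
Proof.
by rewrite /edge_weight; case: eqP => // _; exact: bernoulli_pmf_ge0.
Qed.

Lemma edge_weight1 z e : \sum_b edge_weight z e b = 1.
Proof.
rewrite big_bool /edge_weight; case: eqP => _ /=; first by rewrite add0r.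
by rewrite addrC subrK.
Qed.

(** The labels and edges of n nodes take finitely many values, so an event on
    them is a finite union of events of known probability. *)
Lemma prob_model_event (B : {ffun 'I_n -> 'I_Q} ->
    {ffun 'I_n * 'I_n -> bool} -> bool) :
  measurable [set w | B (labels w) (edges w)] /\
  (P [set w | B (labels w) (edges w)] <=
   (model_mean (fun z x => (B z x)%:R))%:E)%E.
Proof.
pose ok (u : {ffun 'I_n -> 'I_Q} * {ffun 'I_n * 'I_n -> bool}) :=
  B u.1 u.2 && [forall i, ~~ u.2 (i, i)].
pose F u := label_event u.1 `&` edge_event u.2.
have mF u : measurable (F u).
  by apply: measurableI; [exact: measurable_label_event|exact: measurable_edge_event].
have -> : [set w | B (labels w) (edges w)] = \big[setU/set0]_(u | ok u) F u.
  rewrite -(bigcup_pred ok F); apply/seteqP; split => w /=.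
    move=> Bw; exists (labels w, edges w); last first.
      by split=> [i|i j _]; rewrite ffunE.
    have [_ [_ Xd _]] := modelZX.
    by apply/andP; split => //; apply/forallP => i; rewrite ffunE Xd.
  case=> -[z x] /andP[Bzx /forallP xd] [wz wx].
  have -> : labels w = z by apply/ffunP => i; rewrite ffunE wz.
  have -> // : edges w = x.
  apply/ffunP => -[i j]; rewrite ffunE /=; case: (eqVneq i j) => [<-|/wx //].
  by have [_ [_ -> _]] := modelZX; have /= /negPf -> := xd i.
have [m le] : measurable (\big[setU/set0]_(u | ok u) F u) /\
   (P (\big[setU/set0]_(u | ok u) F u) <= \sum_(u | ok u) P (F u))%E.
  apply: (big_ind2 (fun A p => measurable A /\ (P A <= p)%E)).
  - by split; rewrite ?measure0.
  - move=> A p A' p' [mA Ap] [mA' Ap']; split; first exact: measurableU.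
    by apply: le_trans (measureU2 _ mA mA') _; exact: leeD.
  - by move=> u _; split.
split => //; apply: le_trans le _.
rewrite (eq_bigr (fun u : {ffun 'I_n -> 'I_Q} * {ffun 'I_n * 'I_n -> bool} =>
   ((\prod_i label_weight i (u.1 i)) *
   \prod_e edge_weight u.1 e (u.2 e))%:E)) => [|u /andP[_ /forallP xd]]; last first.
  by rewrite /F prob_label_edge_event // => i; have /= /negPf := xd i.
rewrite sumEFin lee_fin /model_mean /product_mean.
under [leRHS]eq_bigr do rewrite mulr_sumr.
rewrite pair_bigA /= big_mkcond /=; apply: ler_sum => -[z x] _ /=.
have ge0 : 0 <= (\prod_i label_weight i (z i)) * (\prod_e edge_weight z e (x e)).
  by rewrite mulr_ge0 // prodr_ge0 // => *; rewrite ?label_weight_ge0 ?edge_weight_ge0.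
rewrite mulrA /ok /=; case: (B z x) => /=; last by rewrite mulr0.
by rewrite mulr1; case: ifP.
Qed.

Definition edge_noise (z : {ffun 'I_n -> 'I_Q}) (e : 'I_n * 'I_n) (b : bool) : R :=
  if e.1 == e.2 then 0 else b%:R - pi (z e.1) (z e.2).

Definition gram (z : {ffun 'I_n -> 'I_Q}) (x : {ffun 'I_n * 'I_n -> bool}) : R :=
  \sum_j \sum_k (\sum_i edge_noise z (i, j) (x (i, j)) *
                       edge_noise z (i, k) (x (i, k))) ^+ 2.

Definition label_noise a (i : 'I_n) q : R := (q == a)%:R - alpha 0 a.

Definition impossible (z : {ffun 'I_n -> 'I_Q}) (x : {ffun 'I_n * 'I_n -> bool}) :=
  [exists e, edge_weight z e (x e) == 0].

Definition atypical eps z x : bool :=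
  [|| impossible z x, eps ^+ 4 * n%:R ^+ 4 <= gram z x |
   [exists a, eps ^+ 2 * n%:R ^+ 2 <= (\sum_i label_noise a i (z i)) ^+ 2]].

Lemma mean_impossible z :
  product_mean (edge_weight z) (fun x => (impossible z x)%:R) = 0.
Proof.
rewrite /product_mean big1 // => x _; rewrite /impossible.
case: existsP => [[e /eqP e0]|_]; last by rewrite mulr0.
by rewrite (bigD1 e) //= e0 !mul0r.
Qed.

Lemma mean_gram z : product_mean (edge_weight z) (gram z) <= 2 * n%:R ^+ 3.
Proof.
apply: product_mean_gram.
- exact: edge_weight_ge0.
- exact: edge_weight1.
- move=> e b; rewrite /edge_noise; case: eqP => _; first by rewrite normr0.
  have /andP[? ?] := pi01 (z e.1) (z e.2).
  by rewrite ler_norml; apply/andP; split; case: b => /=; lra.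
- move=> e; rewrite big_bool /edge_weight /edge_noise; case: eqP => _ /=.
    by rewrite !mulr0 addr0.
  by ring.
Qed.

Lemma mean_label_noise a :
  product_mean label_weight (fun z => (\sum_i label_noise a i (z i)) ^+ 2) <= n%:R.
Proof.
apply: variance_sum_le.
- exact: label_weight_ge0.
- by move=> i; exact: alpha1.
- move=> i q; rewrite /label_noise; have /andP[? ?] := alpha01 a.
  by rewrite ler_norml; apply/andP; split; case: eqP => _ /=; lra.
- move=> i; rewrite /label_weight /label_noise.
  under eq_bigr do rewrite mulrBr.
  rewrite sumrB -mulr_suml alpha1 mul1r (bigD1 a) //= eqxx mulr1 big1 ?addr0 ?subrr //.
  by move=> q /negPf ->; rewrite mulr0.
Qed.

Lemma atypical_le eps z x : (0 < n)%N -> 0 < eps ->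
  (atypical eps z x)%:R <= (impossible z x)%:R +
    (eps ^+ 4 * n%:R ^+ 4)^-1 * gram z x +
    \sum_a (eps ^+ 2 * n%:R ^+ 2)^-1 * (\sum_i label_noise a i (z i)) ^+ 2.
Proof.
move=> n0 e0; have n1 : 0 < n%:R :> R by rewrite ltr0n.
have c4 : 0 < eps ^+ 4 * n%:R ^+ 4 by rewrite mulr_gt0 ?exprn_gt0.
have c2 : 0 < eps ^+ 2 * n%:R ^+ 2 by rewrite mulr_gt0 ?exprn_gt0.
have t1 : 0 <= (impossible z x)%:R :> R by [].
have t2 : 0 <= (eps ^+ 4 * n%:R ^+ 4)^-1 * gram z x.
  rewrite mulr_ge0 ?invr_ge0 ?(ltW c4) //.
  by do 2!(apply: sumr_ge0 => ? _); exact: sqr_ge0.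
have t3 a : 0 <= (eps ^+ 2 * n%:R ^+ 2)^-1 * (\sum_i label_noise a i (z i)) ^+ 2.
  by rewrite mulr_ge0 ?invr_ge0 ?sqr_ge0 ?(ltW c2).
have t4 (p : pred 'I_Q) : 0 <= \sum_(a | p a)
    (eps ^+ 2 * n%:R ^+ 2)^-1 * (\sum_i label_noise a i (z i)) ^+ 2.
  exact: sumr_ge0.
have t4T := t4 xpredT.
rewrite /atypical; case: (impossible z x) t1 => /= t1; first by lra.
case: (leP (eps ^+ 4 * n%:R ^+ 4)) => /= [le|_].
  have : 1 <= (eps ^+ 4 * n%:R ^+ 4)^-1 * gram z x by rewrite mulrC ler_pdivlMr ?mul1r.
  lra.
case: existsP => [[a le]|_] /=; last by lra.
have : 1 <= (eps ^+ 2 * n%:R ^+ 2)^-1 * (\sum_i label_noise a i (z i)) ^+ 2.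
  by rewrite mulrC ler_pdivlMr ?mul1r.
rewrite (bigD1 a) //=; have := t4 (fun b => b != a); lra.
Qed.

(** Markov's inequality for the Gram matrix, Chebyshev's for the label counts:
    2 n^3 / (eps n)^4 and Q n / (eps n)^2 are both of order 1 / n. *)
Lemma prob_atypical eps : (0 < n)%N -> 0 < eps ->
  measurable [set w | atypical eps (labels w) (edges w)] /\
  (P [set w | atypical eps (labels w) (edges w)] <=
   ((2 / eps ^+ 4 + Q%:R / eps ^+ 2) * n%:R^-1)%:E)%E.
Proof.
move=> n0 e0; have n1 : 0 < n%:R :> R by rewrite ltr0n.
have [mA leA] := prob_model_event (atypical eps); split => //.
apply: le_trans leA _; rewrite lee_fin /model_mean.
have c4 : 0 < (eps ^+ 4 * n%:R ^+ 4)^-1 by rewrite invr_gt0 mulr_gt0 ?exprn_gt0.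
have c2 : 0 < (eps ^+ 2 * n%:R ^+ 2)^-1 by rewrite invr_gt0 mulr_gt0 ?exprn_gt0.
pose V a (z : {ffun 'I_n -> 'I_Q}) := (\sum_i label_noise a i (z i)) ^+ 2.
pose H z := (eps ^+ 4 * n%:R ^+ 4)^-1 * (2 * n%:R ^+ 3) +
  \sum_a (eps ^+ 2 * n%:R ^+ 2)^-1 * V a z.
apply: (le_trans (y := product_mean label_weight H)).
  apply: product_mean_le => [|z]; first exact: label_weight_ge0.
  apply: le_trans (product_mean_le (edge_weight_ge0 z)
    (fun x => atypical_le z x n0 e0)) _.
  rewrite !product_meanD mean_impossible add0r product_meanZ /H.
  rewrite product_mean_cst; last exact: edge_weight1.
  by rewrite lerD2r ler_pM2l // mean_gram.
rewrite product_meanD product_mean_cst ?product_mean_sum; last by move=> i; exact: alpha1.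
have -> : (2 / eps ^+ 4 + Q%:R / eps ^+ 2) * n%:R^-1 =
    (eps ^+ 4 * n%:R ^+ 4)^-1 * (2 * n%:R ^+ 3) +
    \sum_(a < Q) (eps ^+ 2 * n%:R ^+ 2)^-1 * n%:R.
  rewrite sumr_const card_ord -[in RHS](mulr_natl _ Q).
  by field; rewrite !gt_eqF.
rewrite lerD2l; apply: ler_sum => a _; rewrite product_meanZ ler_pM2l //.
exact: mean_label_noise.
Qed.

Lemma typicalP eps w : (0 < n)%N -> 0 < eps -> ~~ atypical eps (labels w) (edges w) ->
  [/\ compatible_edges (fun i => labels w i) pi (observed X n w),
      small_bilinear (edge_dev (fun i => labels w i) pi (observed X n w)) eps &
      forall a, `|n%:R^-1 * (\sum_i (labels w i == a)%:R) - alpha 0 a| <= eps].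
Proof.
move=> n0 e0; have n1 : 0 < n%:R :> R by rewrite ltr0n.
rewrite /atypical !negb_or -ltNge => /and3P[poss gram_lt /existsPn noise_lt].
split.
- move=> i j ij; move/existsPn: poss => /(_ (i, j)).
  by rewrite /edge_weight /= (negPf ij) [edges w _]ffunE /observed mxE.
- move=> u v u01 v01; rewrite -(@ler_pXn2r _ 4) ?nnegrE //; last first.
    by rewrite mulr_ge0 ?(ltW e0) ?sqr_ge0.
  rewrite -[in leLHS]normrX ger0_norm ?exprn_even_ge0 //.
  apply: le_trans (bilinear_gram _ u01 v01) _.
  have -> : (eps * n%:R ^+ 2) ^+ 4 = n%:R ^+ 4 * (eps ^+ 4 * n%:R ^+ 4) by ring.
  rewrite ler_pM2l ?exprn_gt0 //; apply: le_trans (ltW gram_lt).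
  rewrite le_eqVlt; apply/orP; left; apply/eqP.
  apply: eq_bigr => j _; apply: eq_bigr => k _; congr (_ ^+ 2).
  apply: eq_bigr => i _; rewrite /edge_dev /edge_noise /=.
  by rewrite ![observed _ _ _ _ _]mxE !ffunE /=.
- move=> a; have := noise_lt a; rewrite -ltNge => /ltW.
  have -> : \sum_i label_noise a i (labels w i) =
      n%:R * (n%:R^-1 * (\sum_i (labels w i == a)%:R) - alpha 0 a).
    rewrite /label_noise sumrB sumr_const card_ord -(mulr_natl _ n).
    by field; rewrite gt_eqF.
  rewrite exprMn mulrC ler_pM2r ?exprn_gt0 //.
  by rewrite -(ler_sqrt _ (sqr_ge0 _)) !sqrtr_sqr (gtr0_norm e0).
Qed.

End fixed_size.
End random_graph.

(** * Distances inducing the usual topology *)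

Section distance.
Variables (R : realType) (Q : nat) (d0 : 'rV[R]_Q -> 'rV[R]_Q -> R).
Hypotheses (hd : is_distance d0) (hdtop : induces_usual_topology d0).

Lemma open_distance_gt b e : open [set a | e < d0 a b].
Proof.
have [_ _ dC dT] := hd; rewrite openE => a /= ea; apply/hdtop.
exists (d0 a b - e); first by rewrite subr_gt0.
by move=> a' /=; have := dT a a' b; lra.
Qed.

Lemma open_relabel s (A : set 'rV[R]_Q) : open A -> open (relabel_alpha s @^-1` A).
Proof.
rewrite !openE => oA a /= /oA /nbhs_ballP [r r0 rA]; apply/nbhs_ballP.
exists r => // a' [_ aa']; apply: rA; split => // i q.
by rewrite !mxE; exact: aa'.
Qed.

Lemma dist_upto_ge0 pi a b : 0 <= dist_upto d0 pi a b.
Proof. by have [d_ge0 _ _ _] := hd; apply: le_bigmin. Qed.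

Lemma distance_lt_ball (b : 'rV[R]_Q) e : 0 < e ->
  exists2 r : R, 0 < r &
    forall a : 'rV[R]_Q, (forall q, `|a 0 q - b 0 q| <= r) -> d0 a b < e.
Proof.
move=> e0; have [_ _ dC _] := hd.
have /nbhs_ballP [r r0 rP] : nbhs b [set a | d0 b a < e] by apply/hdtop; exists e.
rewrite /= in r0; exists (r / 2); first by rewrite divr_gt0.
move=> a ab; rewrite dC; apply: rP; split; first exact: r0.
move=> i q; rewrite (ord1 i) /ball /= distrC.
by apply: le_lt_trans (ab q) _; lra.
Qed.

Lemma dist_upto_lt pi a b (s : 'S_Q) e : relabel_pi s pi = pi ->
  d0 (relabel_alpha s a) b < e -> dist_upto d0 pi a b < e.
Proof.
by move=> /eqP s_pi; apply: le_lt_trans; exact: bigmin_le_cond.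
Qed.

Lemma measurable_dist_upto_gt d (T : measurableType d) (Y : T -> 'rV[R]_Q) pi b e :
  borel_measurable Y -> measurable [set w | e < dist_upto d0 pi (Y w) b].
Proof.
move=> mY.
have -> : [set w | e < dist_upto d0 pi (Y w) b] =
    Y @^-1` [set a | e < d0 a b] `&`
    \bigcap_(s in [set s : 'S_Q | relabel_pi s pi == pi])
      Y @^-1` (relabel_alpha s @^-1` [set a | e < d0 a b]).
  apply/seteqP; split => w /=.
    by move=> /bigmin_gtP[e1 e2]; split => // s; exact: e2.
  by move=> [e1 e2]; apply/bigmin_gtP; split => // s; exact: e2.
apply: measurableI; first by apply: mY; exact: open_distance_gt.
apply: fin_bigcap_measurable => [|s _]; first exact: finite_finset.
by apply: mY; apply: open_relabel; exact: open_distance_gt.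
Qed.

End distance.

Lemma measurable_norm_gt d (T : measurableType d) (R : realType) m n
    (Y : T -> 'M[R]_(m, n)) y c :
  borel_measurable Y -> measurable [set w | c < `|Y w - y|].
Proof.
move=> mY; apply: (mY ((fun x : 'M[R]_(m, n) => `|x - y|) @^-1` [set r | c < r])).
apply: open_comp; last exact: open_gt.
move=> x _; have sub_cvg : (fun x : 'M[R]_(m, n) => x - y) @ x --> x - y.
  exact: (@cvgB R 'M[R]_(m, n) _ (nbhs x) _ id (cst y) x y cvg_id (cvg_cst y)).
exact: cvg_norm sub_cvg.
Qed.

Lemma entry_le_norm (R : realType) m n (x : 'M[R]_(m, n)) i j : `|x i j| <= `|x|.
Proof.
rewrite [leRHS]mx_normrE; exact: (le_bigmax _ (fun ij => `|x ij.1 ij.2|) (i, j)).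
Qed.

(** * Consistency *)

Lemma cvg_measure0 d (T : measurableType d) (R : realType)
    (P : probability T R) (A : nat -> set T) :
  (forall n, measurable (A n)) ->
  (forall e : R, 0 < e -> \forall n \near \oo, (P (A n) <= e%:E)%E) ->
  P (A n) @[n --> \oo] --> 0%E.
Proof.
move=> mA small; apply/fine_cvgP; split.
  by apply: nearW => n; exact: fin_num_measure.
apply/cvgrPdist_le => e e0; move: (small e e0); apply: filterS => n.
rewrite -(fineK (fin_num_measure P _ (mA n))) lee_fin => le_e.
by rewrite /= sub0r normrN ger0_norm // fine_ge0.
Qed.

Theorem theorem4p4 (d : measure_display) (T : measurableType d) (R : realType)
  (P : probability T R) (Q : nat) (gamma zeta : R)
  (alpha_star : 'rV[R]_Q) (pi_star : 'M[R]_Q)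
  (Z : nat -> T -> 'I_Q) (X : nat -> nat -> T -> bool)
  (tau_hat : forall n, 'M[bool]_n -> sbm_parameter R Q -> 'M[R]_(n, Q))
  (alpha_tilde : nat -> T -> 'rV[R]_Q) (pi_tilde : nat -> T -> 'M[R]_Q)
  (d0 : 'rV[R]_Q -> 'rV[R]_Q -> R)
  (hzeta : 0 < zeta)
  (hgamma : 0 < gamma < Q%:R^-1)
  (hstar : admissible gamma zeta (alpha_star, pi_star))
  (hsbm : sbm P (alpha_star, pi_star) Z X)
  (htau : is_tau_hat gamma zeta tau_hat)
  (malpha : forall n, borel_measurable (alpha_tilde n))
  (mpi : forall n, borel_measurable (pi_tilde n))
  (htilde : with_high_probability P (fun n =>
     [set w | is_variational_estimator gamma zeta tau_hat (observed X n w)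
                (alpha_tilde n w, pi_tilde n w)]))
  (hrate : bigO_in_probability P
     (fun n w => `|pi_tilde n w - pi_star|) (fun n => n%:R^-1))
  (hd : is_distance d0)
  (hdtop : induces_usual_topology d0) :
  cvg_in_probability P
    (fun n w => dist_upto d0 pi_star (alpha_tilde n w) alpha_star) 0.
Proof.
have /andP[g0 gQ] := hgamma.
have Q0 : (0 < Q)%N.
  by rewrite -(ltr0n R) -invr_gt0; exact: lt_trans gQ.
have [[/= a01 a1 p01] _ _ _] := hstar.
move=> e e0.
have badE n : [set w | e < `|dist_upto d0 pi_star (alpha_tilde n w) alpha_star - 0|] =
    [set w | e < dist_upto d0 pi_star (alpha_tilde n w) alpha_star].
  by apply/seteqP; split => w /=; rewrite subr0 ger0_norm // dist_upto_ge0.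
have mbad n : measurable
    [set w | e < dist_upto d0 pi_star (alpha_tilde n w) alpha_star].
  by apply: measurable_dist_upto_gt.
under eq_fun do rewrite badE.
apply: cvg_measure0 => // p p0.
have [r r0 close] := distance_lt_ball hd hdtop alpha_star e0.
have [eps [delta [N [eps0 delta0 est]]]] :=
  estimator_close Q0 g0 hstar r0.
rewrite /= in est.
have p3 : 0 < p / 3 by rewrite divr_gt0.
have [M rateM] := hrate _ p3.
have [A [mA subA cvgA]] := htilde.
have nearA : \forall n \near \oo, (P (~` A n) <= (p / 3)%:E)%E.
  have /fine_cvgP[_ /cvgrPdist_le /(_ _ p3)] := cvgA.
  apply: filterS => n; rewrite /= => le_p.
  rewrite probability_setC // -(fineK (fin_num_measure P _ (mA n))) -EFinB lee_fin.
  exact: le_trans (ler_norm _) le_p.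
pose C := 2 / eps ^+ 4 + Q%:R / eps ^+ 2.
near=> n.
have Nn : N.+1%:R <= n%:R :> R by near: n; exact: nbhs_infty_ger.
have Mn : M / delta <= n%:R by near: n; exact: nbhs_infty_ger.
have Cn : C / (p / 3) <= n%:R by near: n; exact: nbhs_infty_ger.
have PA : (P (~` A n) <= (p / 3)%:E)%E by near: n.
have PM : (P [set w | (M * n%:R^-1 < `| `|pi_tilde n w - pi_star| |)%R] <= (p / 3)%:E)%E.
  by near: n.
rewrite ler_nat in Nn; have n0 : (0 < n)%N by exact: leq_trans Nn.
have n1 : 0 < n%:R :> R by rewrite ltr0n.
have [mB PB] := prob_atypical Q0 a01 a1 p01 hsbm n0 eps0.
pose B := [set w | atypical alpha_star pi_star eps (labels Z n w) (edges X n w)].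
pose F := [set w | M * n%:R^-1 < `| `|pi_tilde n w - pi_star| |].
have mF : measurable F.
  rewrite /F (_ : [set w | _] = [set w | M * n%:R^-1 < `|pi_tilde n w - pi_star|]).
    exact: measurable_norm_gt.
  by apply/seteqP; split => w /=; rewrite normr_id.
have mA' : measurable (~` A n) by apply: measurableC.
(* Outside of three events of small probability -- no estimator, pi far from
   pi*, atypical graph -- the deterministic statement applies. *)
have cover : [set w | e < dist_upto d0 pi_star (alpha_tilde n w) alpha_star] `<=`
    ~` A n `|` F `|` B.
  move=> w /=; apply: contraPP => /not_orP[/not_orP[/contrapT Aw Fw] Bw].
  apply/negP; rewrite -leNgt.
  move/negP: Bw => Bw; have [compat bil count] := typicalP n0 eps0 Bw.
  have rate q l : `|pi_tilde n w q l - pi_star q l| <= delta.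
    have := entry_le_norm (pi_tilde n w - pi_star) q l; rewrite !mxE => le_norm.
    apply: le_trans le_norm _; move/negP: Fw; rewrite -leNgt normr_id => /le_trans; apply.
    by rewrite ler_pdivrMr // mulrC -ler_pdivrMr.
  have [s s_pi s_close] := est n (observed X n w) _ tau_hat
    (alpha_tilde n w, pi_tilde n w) (ltnW Nn) htau compat bil count rate (subA n w Aw).
  apply/ltW/(dist_upto_lt s_pi); apply: close => q; rewrite mxE.
  exact: s_close.
have PBp : (P B <= (p / 3)%:E)%E.
  apply: le_trans PB _; rewrite lee_fin -/C ler_pdivrMr //.
  by rewrite mulrC -ler_pdivrMr.
apply: (le_trans (le_measure P _ _ cover)).
- by rewrite inE.
- by rewrite inE; do 2?apply: measurableU.
have -> : p = p / 3 + p / 3 + p / 3 by field.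
rewrite !EFinD.
apply: (le_trans (measureU2 _ _ mB)); first exact: measurableU.
apply: leeD => //; apply: (le_trans (measureU2 _ mA' mF)).
exact: leeD.
Unshelve. all: by end_near. Qed.
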